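(* Let $p$ be a prime, $S$ a finite $p$-group, $\mathcal{F}$ a saturated fusion system over $S$, and let $n$ denote the cardinality of $Cl(\mathcal{F})$. For a prime ideal $\mathcal{J}$ of $A(\mathcal{F})_{(p)}$, call the characteristic of $A(\mathcal{F})_{(p)}/\mathcal{J}$ the type of $\mathcal{J}$. The prime ideals of $A(\mathcal{F})_{(p)}$ are the following: - Type $p$. There is only one prime ideal of type $p$, which is maximal: $$\mathcal{J}_{S,p} = \{ X \in A(\mathcal{F})_{(p)} \mid \Phi_S(X) \equiv 0 \bmod p \} = \big\langle \{\alpha_{[P]_{\mathcal{F}}} \mid P<S \}\cup \{p \cdot \alpha_{[S]_{\mathcal{F}}}\} \big\rangle .$$ - Type $0$. There are exactly $n$ prime ideals of type $0$, one per class $[P]_{\mathcal{F}} \in Cl(\mathcal{F})$ (distinct classes giving distinct ideals, and the ideal depending only on the class): $$\mathcal{J}_{P,0} = \{ X \in A(\mathcal{F})_{(p)} \mid \Phi_P(X) =0 \} = \big\langle \big\{ \alpha_{[Q]_{\mathcal{F}}} - \Phi_P( \alpha_{[Q]_{\mathcal{F}}} ) \cdot \alpha_{[S]_{\mathcal{F}}} \mid Q<S \big\} \big\rangle .$$ All prime ideals of type $0$ are minimal prime ideals and are contained in $\mathcal{J}_{S,p}$.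
   Context: Fusion systems. Let $p$ be a prime and $S$ a finite $p$-group. A fusion system $\mathcal{F}$ over $S$ is a category whose objects are the subgroups of $S$ and whose morphism sets $\mathcal{F}(P,Q)$ satisfy: (i) every morphism in $\mathcal{F}(P,Q)$ is an injective group homomorphism $P\to Q$; (ii) for every $s\in S$ with $sPs^{-1}\leq Q$, the map $P\to Q$, $x\mapsto sxs^{-1}$ belongs to $\mathcal{F}(P,Q)$; (iii) if $\varphi\in\mathcal{F}(P,Q)$ then $\varphi:P\to\varphi(P)$ and $\varphi^{-1}:\varphi(P)\to P$ are morphisms of $\mathcal{F}$. Subgroups $P,Q$ are $\mathcal{F}$-isomorphic ($P\sim_{\mathcal{F}}Q$) if they are isomorphic in $\mathcal{F}$; $[P]_{\mathcal{F}}$ is the class of $P$ and $Cl(\mathcal{F})$ the set of classes. $P\lesssim_{\mathcal{F}}Q$ means $\mathcal{F}(P,Q)\neq\emptyset$; this induces a partial order on $Cl(\mathcal{F})$. $\mathcal{F}$ is saturated if each class in $Cl(\mathcal{F})$ contains a subgroup $P$ such that: $\mathrm{Aut}_S(P)$ (automorphisms of $P$ induced by conjugation by elements of $N_S(P)$) is a Sylow $p$-subgroup of $\mathrm{Aut}_{\mathcal{F}}(P)=\mathcal{F}(P,P)$; and, for each $Q\leq S$ and each isomorphism $\varphi:Q\to P$ in $\mathcal{F}$, $\varphi$ extends to a morphism in $\mathcal{F}(N_\varphi,S)$, where $N_\varphi=\{g\in N_S(Q)\mid \varphi c_g\varphi^{-1}\in \mathrm{Aut}_S(P)\}$ and $c_g(x)=gxg^{-1}$.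 Burnside rings. $A_+(S)$ is the semiring of isomorphism classes of finite $S$-sets (disjoint union and cartesian product), and the Burnside ring $A(S)$ is its Grothendieck ring; it is free over $\mathbb{Z}$ on the classes $[S/P]$, one per $S$-conjugacy class of subgroups. For $P\leq S$, $\Phi_P:A(S)\to\mathbb{Z}$ is the ring homomorphism with $\Phi_P([X])=|X^P|$ (number of $P$-fixed points) for each finite $S$-set $X$. An element $X\in A(S)$ is $\mathcal{F}$-stable if for every $P\leq S$ and $\varphi\in\mathcal{F}(P,S)$ the restrictions of $X$ to $A(P)$ along $\varphi$ and along the inclusion $P\hookrightarrow S$ coincide; equivalently $\Phi_P(X)=\Phi_Q(X)$ whenever $P\sim_{\mathcal{F}}Q$. The $\mathcal{F}$-stable elements form a subring $A(\mathcal{F})$ of $A(S)$, the Burnside ring of $\mathcal{F}$. The $p$-localized Burnside ring is $A(\mathcal{F})_{(p)}=\mathbb{Z}_{(p)}\otimes_{\mathbb{Z}}A(\mathcal{F})$, with $A(\mathcal{F})$ embedded via $X\mapsto1\otimes X$; $\Phi_P$ extends $\mathbb{Z}_{(p)}$-linearly to a ring homomorphism $\Phi_P:A(\mathcal{F})_{(p)}\to\mathbb{Z}_{(p)}$, and ''$\equiv0\bmod p$'' means membership in $p\mathbb{Z}_{(p)}$. Basis (known result of Reeh for saturated $\mathcal{F}$). There are $\mathcal{F}$-stable elements $\alpha_{[P]_{\mathcal{F}}}\in A_+(S)$, one per class $[P]_{\mathcal{F}}\in Cl(\mathcal{F})$, forming a $\mathbb{Z}$-basis of $A(\mathcal{F})$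 (hence a $\mathbb{Z}_{(p)}$-basis of $A(\mathcal{F})_{(p)}$), such that: (i) $\alpha_{[P]_{\mathcal{F}}}$ is a linear combination of the $[S/P']$ with $P'\lesssim_{\mathcal{F}}P$; (ii) for every $P_0\in[P]_{\mathcal{F}}$ with $|N_S(P_0)|$ maximal among members of $[P]_{\mathcal{F}}$, the coefficient of $[S/P_0]$ in $\alpha_{[P]_{\mathcal{F}}}$ is $1$, and its coefficient in $\alpha_{[Q]_{\mathcal{F}}}$ is $0$ for $[Q]_{\mathcal{F}}\neq[P]_{\mathcal{F}}$; (iii) for such $P_0$, $\Phi_{P_0}(\alpha_{[P]_{\mathcal{F}}})=|N_S(P_0)|/|P_0|$; (iv) $\Phi_Q(\alpha_{[P]_{\mathcal{F}}})\neq0$ if and only if $Q\lesssim_{\mathcal{F}}P$. In particular $\alpha_{[S]_{\mathcal{F}}}=[S/S]$ is the unit. $\langle\cdot\rangle$ denotes the ideal of $A(\mathcal{F})_{(p)}$ generated by a set; $P<S$ means $P$ is a proper subgroup of $S$. *)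

(* Defs.v *)
From HB Require Import structures.
From mathcomp Require Import boolp classical_sets.
From mathcomp Require Import all_boot all_order all_algebra.
From mathcomp Require Import all_fingroup all_solvable.
From mathcomp Require Import ring.

Set Implicit Arguments.
Unset Strict Implicit.
Unset Printing Implicit Defensive.

Import GRing.Theory.
Local Open Scope ring_scope.
Local Open Scope quotient_scope.

(* The p-group S is the whole of a finGroupType; its subgroups are the terms of
   type {group S}. *)

Section FusionSystem.
Variable S : finGroupType.
Implicit Types P Q R : {group S}.
Local Open Scope group_scope.

(* A map P -> Q is represented by the function S -> S extending it by 1 outside
   P, so that each map has exactly one representative; this representation is
   stable under composition because group morphisms send 1 to 1. *)
Definition conj_ffun P (s : S) : {ffun S -> S} :=
  [ffun x => if x \in P then s * x * s^-1 else 1].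

Record fusion_system := FusionSystem {
  fhom :> {group S} -> {group S} -> {set {ffun S -> S}};
  fhom_on : forall P Q f, f \in fhom P Q -> f \in pffun_on 1 P Q;
  fhom_morphic : forall P Q f, f \in fhom P Q -> morphic P f;
  fhom_inj : forall P Q f, f \in fhom P Q -> {in P &, injective f};
  fhom_comp : forall P Q R f g, f \in fhom P Q -> g \in fhom Q R ->
    [ffun x => g (f x)] \in fhom P R;
  fhom_conj : forall P Q s, (forall x, x \in P -> s * x * s^-1 \in Q) ->
    conj_ffun P s \in fhom P Q;
  fhom_img : forall P Q R f, f \in fhom P Q -> f @: P = R ->
    f \in fhom P R /\ exists2 g, g \in fhom R P & {in P, cancel f g}
}.

Variable F : fusion_system.

Definition fiso P Q (f : {ffun S -> S}) : bool :=
  (f \in F P Q) &&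
  [exists g in F Q P, [forall x in P, g (f x) == x]
                   && [forall y in Q, f (g y) == y]].

Definition fisog P Q : bool := [exists f, fiso P Q f].

Definition fclass P : {set {group S}} := [set Q | fisog P Q].

Definition fclasses : {set {set {group S}}} := [set fclass P | P : {group S}].

Definition fsub P Q : bool := F P Q != set0.

(* Aut_F(P) and Aut_S(P), as sets of automorphisms of P in the sense of the
   library: permutations of S which fix every point outside P. *)
Definition autF P : {set {perm S}} :=
  [set a in Aut P | [ffun x => if x \in P then a x else 1] \in F P P].

Definition autS P : {set {perm S}} := conj_aut P @* 'N(P).

(* N_f, where f : Q -> P: the g in N_S(Q) such that f c_g f^-1 is in Aut_S(P). *)
Definition extender Q P (f : {ffun S -> S}) : {set S} :=
  [set g in 'N(Q) | [exists a in autS P,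
     [forall x in Q, f (g * x * g^-1) == a (f x)]]].

Lemma extender_group_set Q P f : fiso Q P f -> group_set (extender Q P f).
Proof.
case/andP=> fQP _.
apply/group_setP; split=> [|g h].
  rewrite in_set group1; apply/existsP; exists 1; rewrite group1 /=.
  by apply/forall_inP=> x _; rewrite mul1g invg1 mulg1 perm1.
rewrite [g \in _]in_set [h \in _]in_set [_ * _ \in _]in_set.
case/andP=> gN /existsP[a /andP[aS /forall_inP ga]].
case/andP=> hN /existsP[b /andP[bS /forall_inP hb]].
rewrite groupM //=; apply/existsP; exists (b * a); rewrite groupM //=.
apply/forall_inP=> x Qx; rewrite permM invMg.
have Qhx : h * x * h^-1 \in Q.
  by rewrite -{1}[h]invgK -mulgA -/(_ ^ _) memJ_norm ?groupV.
by rewrite -(eqP (hb _ Qx)) -(eqP (ga _ Qhx)) !mulgA.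
Qed.

(* <<extender Q P f>> is extender Q P f itself, by extender_group_set. *)
Definition saturated (p : nat) : Prop :=
  forall C, C \in fclasses -> exists P, [/\ P \in C,
    p.-Sylow(autF P) (autS P)
  & forall Q f, fiso Q P f ->
      exists2 g, g \in F <<extender Q P f>>%G [set: S]%G & {in Q, f =1 g}].

Definition fully_normalized P : bool :=
  [forall Q in fclass P, (#|'N(Q)| <= #|'N(P)|)%N].

End FusionSystem.

(* The semiring A_+(G) is bsemi G. Up to isomorphism a finite G-set is an action
   of G on some 'I_n; as in the library actions are on the right, a left action
   being turned into a right one by x.g = g^-1 x. *)
Section GSets.
Variables (S : finGroupType) (G : {group S}).

Record gset := GSet { gset_card : nat; gset_act : action G 'I_gset_card }.

HB.instance Definition _ := gen_eqMixin gset.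
HB.instance Definition _ := gen_choiceMixin gset.

Definition act_iso (T1 T2 : Type) (to1 : action G T1) (to2 : action G T2) :=
  exists2 f : T1 -> T2, bijective f &
    forall x g, g \in G -> f (to1 x g) = to2 (f x) g.

Lemma act_iso_refl T (to : action G T) : act_iso to to.
Proof. by exists id => //; exists id. Qed.

Lemma act_iso_sym T1 T2 (to1 : action G T1) (to2 : action G T2) :
  act_iso to1 to2 -> act_iso to2 to1.
Proof.
case=> f [f' fK f'K] fM; exists f'; first by exists f.
by move=> x g Gg; rewrite -{1}(f'K x) -fM // fK.
Qed.

Lemma act_iso_trans T1 T2 T3 (to1 : action G T1) (to2 : action G T2)
    (to3 : action G T3) :
  act_iso to1 to2 -> act_iso to2 to3 -> act_iso to1 to3.
Proof.
case=> f fB fM [g gB gM]; exists (g \o f); first exact: bij_comp.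
by move=> x a Ga /=; rewrite fM // gM.
Qed.

Definition gset_iso (X Y : gset) : bool :=
  `[< act_iso (gset_act X) (gset_act Y) >].

Lemma gset_iso_equiv : equiv_class_of gset_iso.
Proof.
split=> [X|X Y|Y X Z]; first by apply/asboolP; exact: act_iso_refl.
  by apply/idP/idP=> /asboolP /act_iso_sym ?; exact/asboolP.
by move=> /asboolP XY /asboolP YZ; apply/asboolP; exact: act_iso_trans XY YZ.
Qed.

Canonical gset_iso_canonical := EquivRelPack gset_iso_equiv.

Definition bsemi := {eq_quot gset_iso}.
HB.instance Definition _ := EqQuotient.on bsemi.
HB.instance Definition _ := Choice.on bsemi.

Section OrdAct.
Variables (T : finType) (to : action G T).

Lemma ord_act_subproof :
  is_action G (fun (i : 'I_#|T|) g => enum_rank (to (enum_val i) g)).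
Proof.
split=> [g i j /enum_rank_inj /act_inj /enum_val_inj // | i g h Gg Gh].
by rewrite enum_rankK actMin.
Qed.
Definition ord_act := Action ord_act_subproof.

Lemma ord_act_iso : act_iso to ord_act.
Proof.
exists enum_rank; first exact: enum_rank_bij.
by move=> x g _ /=; rewrite enum_rankK.
Qed.

Definition bclass : bsemi := \pi_bsemi (GSet ord_act).

End OrdAct.

Definition brepr (X : bsemi) := gset_act (generic_quotient.repr X).

Lemma bclassP (T1 T2 : finType) (to1 : action G T1) (to2 : action G T2) :
  act_iso to1 to2 -> bclass to1 = bclass to2.
Proof.
move=> iso12; apply/eqP; rewrite piE; apply/asboolP => /=.
apply: act_iso_trans (ord_act_iso _).
exact: act_iso_trans (act_iso_sym (ord_act_iso _)) iso12.
Qed.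

Lemma breprK (X : bsemi) : bclass (brepr X) = X.
Proof.
rewrite -[RHS]reprK; apply/eqP; rewrite piE; apply/asboolP => /=.
exact: act_iso_sym (ord_act_iso _).
Qed.

Lemma brepr_bclass (T : finType) (to : action G T) : act_iso to (brepr (bclass to)).
Proof.
apply: act_iso_trans (ord_act_iso to) _.
have /eqP : bclass (brepr (bclass to)) = bclass to := breprK _.
rewrite piE => /asboolP /= iso.
apply: act_iso_trans (act_iso_sym iso) (act_iso_sym (ord_act_iso _)).
Qed.

Lemma sum_act_subproof (T1 T2 : finType) (to1 : action G T1) (to2 : action G T2) :
  is_action G (fun (x : T1 + T2) g =>
    match x with inl y => inl (to1 y g) | inr z => inr (to2 z g) end).
Proof.
split=> [g [x|x] [y|y] //= [] /act_inj -> // | [x|x] g h Gg Gh] /=;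
  by rewrite actMin.
Qed.
Definition sum_act T1 T2 to1 to2 := Action (@sum_act_subproof T1 T2 to1 to2).

Lemma prod_act_subproof (T1 T2 : finType) (to1 : action G T1) (to2 : action G T2) :
  is_action G (fun (x : T1 * T2) g => (to1 x.1 g, to2 x.2 g)).
Proof.
split=> [g [x1 x2] [y1 y2] /= [/act_inj -> /act_inj ->] // | x g h Gg Gh] /=.
by rewrite !actMin.
Qed.
Definition prod_act T1 T2 to1 to2 := Action (@prod_act_subproof T1 T2 to1 to2).

Lemma triv_act_subproof (T : finType) : is_action G (fun (x : T) (_ : S) => x).
Proof. by split=> [g x y|x g h]. Qed.
Definition triv_act T := Action (@triv_act_subproof T).

Lemma sum_act_iso (T1 T2 U1 U2 : finType) (to1 : action G T1) (to2 : action G T2)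
    (uo1 : action G U1) (uo2 : action G U2) :
  act_iso to1 uo1 -> act_iso to2 uo2 ->
  act_iso (sum_act to1 to2) (sum_act uo1 uo2).
Proof.
move=> [f [f' fK f'K] fM] [h [h' hK h'K] hM].
exists (fun x => match x with inl y => inl (f y) | inr z => inr (h z) end).
  exists (fun x => match x with inl y => inl (f' y) | inr z => inr (h' z) end).
    by case=> x; rewrite ?fK ?hK.
  by case=> x; rewrite ?f'K ?h'K.
by case=> x g Gg /=; rewrite ?fM ?hM.
Qed.

Lemma prod_act_iso (T1 T2 U1 U2 : finType) (to1 : action G T1) (to2 : action G T2)
    (uo1 : action G U1) (uo2 : action G U2) :
  act_iso to1 uo1 -> act_iso to2 uo2 ->
  act_iso (prod_act to1 to2) (prod_act uo1 uo2).
Proof.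
move=> [f [f' fK f'K] fM] [h [h' hK h'K] hM].
exists (fun x => (f x.1, h x.2)).
  by exists (fun x => (f' x.1, h' x.2)) => -[x y] /=; rewrite ?fK ?hK ?f'K ?h'K.
by case=> x y g Gg /=; rewrite ?fM ?hM.
Qed.

Definition bzero : bsemi := bclass (triv_act void).
Definition bone : bsemi := bclass (triv_act unit).
Definition badd (X Y : bsemi) : bsemi := bclass (sum_act (brepr X) (brepr Y)).
Definition bmul (X Y : bsemi) : bsemi := bclass (prod_act (brepr X) (brepr Y)).

Lemma bclassD (T1 T2 : finType) (to1 : action G T1) (to2 : action G T2) :
  badd (bclass to1) (bclass to2) = bclass (sum_act to1 to2).
Proof. by apply: bclassP; apply: act_iso_sym; apply: sum_act_iso; apply: brepr_bclass. Qed.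

Lemma bclassM (T1 T2 : finType) (to1 : action G T1) (to2 : action G T2) :
  bmul (bclass to1) (bclass to2) = bclass (prod_act to1 to2).
Proof. by apply: bclassP; apply: act_iso_sym; apply: prod_act_iso; apply: brepr_bclass. Qed.

Lemma baddA : associative badd.
Proof.
move=> X Y Z; rewrite -(breprK X) -(breprK Y) -(breprK Z) !bclassD.
apply: bclassP; exists (fun u => match u with inl x => inl (inl x)
  | inr (inl y) => inl (inr y) | inr (inr z) => inr z end).
  exists (fun u => match u with inl (inl x) => inl x
    | inl (inr y) => inr (inl y) | inr z => inr (inr z) end).
    by case=> [|[]].
  by case=> [[]|].
by case=> [|[]].
Qed.

Lemma baddC : commutative badd.
Proof.
move=> X Y; rewrite -(breprK X) -(breprK Y) !bclassD; apply: bclassP.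
exists (fun u => match u with inl x => inr x | inr y => inl y end).
  by exists (fun u => match u with inl x => inr x | inr y => inl y end); case.
by case.
Qed.

Lemma badd0 : left_id bzero badd.
Proof.
move=> X; rewrite -(breprK X) bclassD; apply: bclassP.
exists (fun u : void + _ => match u with inl v => match v with end | inr y => y end).
  by exists inr => // -[[]|].
by case=> [[]|].
Qed.

HB.instance Definition _ := GRing.isNmodule.Build bsemi baddA baddC badd0.

Lemma bmulA : associative bmul.
Proof.
move=> X Y Z; rewrite -(breprK X) -(breprK Y) -(breprK Z) !bclassM.
apply: bclassP; exists (fun u => (u.1, u.2.1, u.2.2)) => //.
by exists (fun u => (u.1.1, (u.1.2, u.2))); [case=> ? [] | case=> -[]].
Qed.

Lemma bmulC : commutative bmul.
Proof.
move=> X Y; rewrite -(breprK X) -(breprK Y) !bclassM; apply: bclassP.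
by exists (fun u => (u.2, u.1)) => //; exists (fun u => (u.2, u.1)); case.
Qed.

Lemma bmul1 : left_id bone bmul.
Proof.
move=> X; rewrite -(breprK X) bclassM; apply: bclassP.
by exists snd => //; exists (pair tt) => // -[[]].
Qed.

Lemma bmulDl : left_distributive bmul badd.
Proof.
move=> X Y Z; rewrite -(breprK X) -(breprK Y) -(breprK Z) !(bclassD, bclassM).
apply: bclassP; exists (fun u => match u with
  (inl x, z) => inl (x, z) | (inr y, z) => inr (y, z) end).
  exists (fun u => match u with
    inl (x, z) => (inl x, z) | inr (y, z) => (inr y, z) end).
    by case=> -[].
  by case=> -[].
by case=> -[].
Qed.

Lemma bmul0 : left_zero bzero bmul.
Proof.
move=> X; rewrite -(breprK X) bclassM; apply: bclassP.
exists (fun u : void * _ => match u.1 with end); last by case=> -[].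
by exists (fun v : void => match v with end); case=> -[].
Qed.

HB.instance Definition _ :=
  GRing.Nmodule_isComPzSemiRing.Build bsemi bmulA bmulC bmul1 bmulDl bmul0.

Lemma bclass_add (T1 T2 : finType) (to1 : action G T1) (to2 : action G T2) :
  bclass to1 + bclass to2 = bclass (sum_act to1 to2).
Proof. exact: bclassD. Qed.

Lemma bclass_mul (T1 T2 : finType) (to1 : action G T1) (to2 : action G T2) :
  bclass to1 * bclass to2 = bclass (prod_act to1 to2).
Proof. exact: bclassM. Qed.

(* |X^P|, for P a subgroup of G. *)
Definition act_mark (P : {group S}) (T : finType) (to : action G T) : int :=
  #|'Fix_to(P)%g|%:Z.

(* The number of orbits isomorphic to the transitive G-set G/P, i.e. of orbits
   of points with stabilizer P, for P a subgroup of G. *)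
Definition act_coef (P : {group S}) (T : finType) (to : action G T) : int :=
  #|orbit to G @: [set x | 'C_G[x | to]%g == P]|%:Z.

Definition semi_mark P (X : bsemi) : int := act_mark P (brepr X).
Definition semi_coef P (X : bsemi) : int := act_coef P (brepr X).

Section EquivariantInjection.
Variables (T1 T2 : finType) (to1 : action G T1) (to2 : action G T2).
Variable f : T1 -> T2.
Hypotheses (fI : injective f)
  (fM : forall x g, g \in G -> f (to1 x g) = to2 (f x) g).

Lemma astab1_inj x : 'C_G[f x | to2]%g = 'C_G[x | to1]%g.
Proof.
apply/setP=> g; rewrite !inE; case Gg: (g \in G) => //=.
by rewrite !sub1set !inE -fM // (inj_eq fI).
Qed.

Lemma orbit_inj x : orbit to2 G (f x) = f @: orbit to1 G x.
Proof.
apply/setP=> y; apply/idP/imsetP => [/orbitP[g Gg <-] | [_ /orbitP[g Gg <-] ->]].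
  by exists (to1 x g); [exact: mem_orbit | rewrite fM].
by rewrite fM // mem_orbit.
Qed.

Lemma afix_inj (P : {group S}) x :
  P \subset G -> (f x \in 'Fix_to2(P)%g) = (x \in 'Fix_to1(P)%g).
Proof.
move=> sPG; apply/afixP/afixP => Fx g Pg; last by rewrite -fM ?(subsetP sPG) // Fx.
by apply: fI; rewrite fM ?(subsetP sPG) // Fx.
Qed.

Lemma coef_inj (P : {group S}) :
  (orbit to2 G \o f) @: [set x | 'C_G[f x | to2]%g == P] =
  [set f @: (O : {set T1}) | O in orbit to1 G @: [set x | 'C_G[x | to1]%g == P]].
Proof.
have -> : [set x | 'C_G[f x | to2]%g == P] = [set x | 'C_G[x | to1]%g == P].
  by apply/setP=> x; rewrite !inE astab1_inj.
by rewrite -imset_comp; apply: eq_imset => x /=; exact: orbit_inj.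
Qed.

End EquivariantInjection.

Lemma act_mark_iso (P : {group S}) (T1 T2 : finType) (to1 : action G T1)
    (to2 : action G T2) :
  P \subset G -> act_iso to1 to2 -> act_mark P to1 = act_mark P to2.
Proof.
move=> sPG [f fB fM]; have fI := bij_inj fB; have [f' fK f'K] := fB.
rewrite /act_mark -(card_imset _ fI); congr (Posz #|pred_of_set _|).
apply/setP=> y; rewrite -(f'K y) mem_imset //.
by rewrite (afix_inj fI fM).
Qed.

Lemma act_coef_iso (P : {group S}) (T1 T2 : finType) (to1 : action G T1)
    (to2 : action G T2) :
  act_iso to1 to2 -> act_coef P to1 = act_coef P to2.
Proof.
move=> [f fB fM]; have fI := bij_inj fB; have [f' fK f'K] := fB.
rewrite /act_coef -(card_imset _ (imset_inj fI)) -(coef_inj fI fM).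
rewrite imset_comp; congr (Posz #|pred_of_set (_ @: pred_of_set _)|).
apply/setP=> y; rewrite inE; apply/imsetP/eqP => [[x] | yP].
  by rewrite inE => /eqP + ->.
by exists (f' y); rewrite ?f'K // inE f'K yP.
Qed.

Lemma semi_mark_bclass (P : {group S}) (T : finType) (to : action G T) :
  P \subset G -> semi_mark P (bclass to) = act_mark P to.
Proof. by move=> sPG; apply/esym/act_mark_iso/brepr_bclass. Qed.

Lemma semi_coef_bclass (P : {group S}) (T : finType) (to : action G T) :
  semi_coef P (bclass to) = act_coef P to.
Proof. exact/esym/act_coef_iso/brepr_bclass. Qed.

Lemma semi_coef_is_additive P : nmod_morphism (semi_coef P).
Proof.
split=> [|X Y].
  rewrite semi_coef_bclass /act_coef; apply/eqP; rewrite eqz_nat cards_eq0.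
  by apply/set0Pn => -[_ /imsetP[[]]].
rewrite -(breprK X) -(breprK Y) bclass_add !semi_coef_bclass /act_coef.
set to1 := brepr X; set to2 := brepr Y; set to := sum_act _ _.
have lI : injective (@inl 'I_(gset_card (generic_quotient.repr X))
  'I_(gset_card (generic_quotient.repr Y))) by move=> ? ? [].
have rI : injective (@inr 'I_(gset_card (generic_quotient.repr X))
  'I_(gset_card (generic_quotient.repr Y))) by move=> ? ? [].
have lM x g : g \in G -> inl (to1 x g) = to (inl x) g by [].
have rM x g : g \in G -> inr (to2 x g) = to (inr x) g by [].
rewrite -(card_imset (orbit to1 G @: _) (imset_inj lI)) -(coef_inj lI lM).
rewrite -(card_imset (orbit to2 G @: _) (imset_inj rI)) -(coef_inj rI rM).
rewrite -PoszD -cardsUI [X in (_ + X)%N](_ : _ = 0%N) ?addn0; last first.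
  apply/eqP; rewrite cards_eq0; apply/set0Pn => -[O /setIP[]].
  case/imsetP=> x _ -> /imsetP[y _ /= E].
  have : inl (to1 x 1%g) \in orbit to G (inr y).
    by rewrite -E; apply/imsetP; exists 1%g; rewrite ?group1.
  by case/imsetP.
rewrite (imset_comp (orbit to G) inl) (imset_comp (orbit to G) inr) -imsetU.
set B := _ :|: _.
suff -> : [set x | 'C_G[x | to]%g == P] = B by [].
apply/setP=> -[x|x]; rewrite in_setU.
  rewrite [_ \in _ @: [set x0 | _]]mem_imset // !in_set orbC.
  by case: imsetP => // -[].
rewrite [X in _ || X]mem_imset // !in_set.
by case: imsetP => // -[].
Qed.
HB.instance Definition _ P := GRing.isNmodMorphism.Build bsemi int (semi_coef P)
  (semi_coef_is_additive P).

End GSets.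

Arguments semi_mark {S G} P X.
Arguments semi_coef {S G} P X.

Section Restriction.
Variable S : finGroupType.
Implicit Types P : {group S}.

Lemma res_act_subproof P (f : {morphism P >-> S}) (T : finType)
    (to : action [set: S]%G T) :
  is_action P (fun x g => to x (f g)).
Proof.
split=> [g|x g h Pg Ph]; first exact: act_inj.
by rewrite morphM // actMin ?inE.
Qed.
Definition res_act P (f : {morphism P >-> S}) T to :=
  Action (@res_act_subproof P f T to).

Definition semi_res P (f : {morphism P >-> S}) (X : bsemi [set: S]%G) : bsemi P :=
  bclass (res_act f (brepr X)).

Lemma semi_res_bclass P (f : {morphism P >-> S}) (T : finType)
    (to : action [set: S]%G T) :
  semi_res f (bclass to) = bclass (res_act f to).
Proof.
apply: bclassP; apply: act_iso_sym; have [h hB hM] := brepr_bclass to.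
by exists h => // x g _; rewrite /= hM ?inE.
Qed.

Lemma semi_res_is_nmod_morphism P (f : {morphism P >-> S}) :
  nmod_morphism (semi_res f).
Proof.
split=> [|X Y].
  by rewrite semi_res_bclass; apply: bclassP; exists id => //; exists id.
rewrite -(breprK X) -(breprK Y) bclass_add !semi_res_bclass bclass_add.
by apply: bclassP; exists id; [exists id | case].
Qed.
HB.instance Definition _ P (f : {morphism P >-> S}) :=
  GRing.isNmodMorphism.Build _ _ (semi_res f) (semi_res_is_nmod_morphism f).

Lemma semi_res_is_monoid_morphism P (f : {morphism P >-> S}) :
  monoid_morphism (semi_res f).
Proof.
split=> [|X Y].
  by rewrite semi_res_bclass; apply: bclassP; exists id => //; exists id.
rewrite -(breprK X) -(breprK Y) bclass_mul !semi_res_bclass bclass_mul.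
by apply: bclassP; exists id; [exists id | case].
Qed.
HB.instance Definition _ P (f : {morphism P >-> S}) :=
  GRing.isMonoidMorphism.Build _ _ (semi_res f) (semi_res_is_monoid_morphism f).

Lemma semi_mark_is_nmod_morphism P :
  nmod_morphism (semi_mark (G := [set: S]%G) P).
Proof.
split=> [|X Y].
  rewrite semi_mark_bclass ?subsetT // /act_mark; apply/eqP.
  by rewrite eqz_nat cards_eq0; apply/set0Pn => -[[]].
rewrite -(breprK X) -(breprK Y) bclass_add !semi_mark_bclass ?subsetT //.
rewrite /act_mark -PoszD; set to1 := brepr X; set to2 := brepr Y.
set to := sum_act _ _; congr Posz.
rewrite -(card_imset 'Fix_to1(P)%g (@inl_inj _ 'I_(gset_card (generic_quotient.repr Y)))).
rewrite -(card_imset 'Fix_to2(P)%g (@inr_inj 'I_(gset_card (generic_quotient.repr X)) _)).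
rewrite -cardsUI [X in (_ + X)%N](_ : _ = 0%N) ?addn0; last first.
  by apply/eqP; rewrite cards_eq0; apply/set0Pn => -[u /setIP[/imsetP[x _ ->] /imsetP[]]].
congr #|pred_of_set _|; apply/setP=> -[x|x]; rewrite in_setU.
  rewrite (mem_imset _ _ (@inl_inj _ _)) (@afix_inj _ _ _ _ to1 to inl) ?subsetT //; last exact: inl_inj.
  by rewrite orbC; case: imsetP => // -[].
rewrite (mem_imset _ _ (@inr_inj _ _)) (@afix_inj _ _ _ _ to2 to inr) ?subsetT //; last exact: inr_inj.
by case: imsetP => // -[].
Qed.
HB.instance Definition _ P := GRing.isNmodMorphism.Build _ _ (semi_mark P)
  (semi_mark_is_nmod_morphism P).

Lemma semi_mark_is_monoid_morphism P :
  monoid_morphism (semi_mark (G := [set: S]%G) P).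
Proof.
split=> [|X Y].
  rewrite semi_mark_bclass ?subsetT // /act_mark; congr Posz.
  rewrite (_ : 'Fix_(_)(_)%g = setT) ?cardsT ?card_unit //.
  by apply/setP=> x; rewrite in_setT; apply/afixP.
rewrite -(breprK X) -(breprK Y) bclass_mul !semi_mark_bclass ?subsetT //.
rewrite /act_mark -PoszM -cardsX; congr (Posz #|pred_of_set _|).
apply/setP=> -[x y]; rewrite in_setX.
apply/afixP/andP => [Fxy | [/afixP Fx /afixP Fy] g Pg /=]; last by rewrite Fx ?Fy.
by split; apply/afixP => g Pg; have [] := Fxy g Pg.
Qed.
HB.instance Definition _ P := GRing.isMonoidMorphism.Build _ _ (semi_mark P)
  (semi_mark_is_monoid_morphism P).

End Restriction.

Section Grothendieck.
Variable R : comPzSemiRingType.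

(* (a, b) stands for the formal difference a - b. *)
Definition groth_eq (x y : R * R) : bool :=
  `[< exists k, x.1 + y.2 + k = y.1 + x.2 + k >].

Lemma groth_eq_equiv : equiv_class_of groth_eq.
Proof.
split=> [x|x y|y x z]; first by apply/asboolP; exists 0.
  by apply/idP/idP=> /asboolP[k E]; apply/asboolP; exists k.
move=> /asboolP[k E] /asboolP[l E']; apply/asboolP; exists (y.1 + y.2 + k + l).
have -> : x.1 + z.2 + (y.1 + y.2 + k + l) = (x.1 + y.2 + k) + (y.1 + z.2 + l).
  by ring.
by rewrite E E'; ring.
Qed.

Canonical groth_eq_canonical := EquivRelPack groth_eq_equiv.

Definition groth := {eq_quot groth_eq}.
HB.instance Definition _ := EqQuotient.on groth.
HB.instance Definition _ := Choice.on groth.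

Definition gpair (a b : R) : groth := \pi_groth (a, b).
Definition gpos (x : groth) : R := (generic_quotient.repr x).1.
Definition gneg (x : groth) : R := (generic_quotient.repr x).2.

Lemma gpairP a b c d :
  (exists k, a + d + k = c + b + k) <-> gpair a b = gpair c d.
Proof.
split=> [E | /eqP]; last by rewrite piE => /asboolP.
by apply/eqP; rewrite piE; apply/asboolP.
Qed.

Lemma gpairK x : gpair (gpos x) (gneg x) = x.
Proof. by rewrite /gpair /gpos /gneg -surjective_pairing reprK. Qed.

Lemma grepr_gpair a b :
  exists k, gpos (gpair a b) + b + k = a + gneg (gpair a b) + k.
Proof. by apply/gpairP; rewrite gpairK. Qed.

Definition gadd (x y : groth) := gpair (gpos x + gpos y) (gneg x + gneg y).
Definition gopp (x : groth) := gpair (gneg x) (gpos x).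
Definition gmul (x y : groth) :=
  gpair (gpos x * gpos y + gneg x * gneg y) (gpos x * gneg y + gneg x * gpos y).

Lemma gpairD a b c d : gadd (gpair a b) (gpair c d) = gpair (a + c) (b + d).
Proof.
have [k E] := grepr_gpair a b; have [l E'] := grepr_gpair c d.
apply/gpairP; exists (k + l); rewrite /= in E E' *.
transitivity ((gpos (gpair a b) + b + k) + (gpos (gpair c d) + d + l)).
  by ring.
by rewrite E E'; ring.
Qed.

Lemma gpairN a b : gopp (gpair a b) = gpair b a.
Proof.
have [k E] := grepr_gpair a b; apply/gpairP; exists k.
by rewrite [_ + a]addrC -E addrC; ring.
Qed.

Lemma gpairM a b c d :
  gmul (gpair a b) (gpair c d) = gpair (a * c + b * d) (a * d + b * c).
Proof.
have [k E] := grepr_gpair a b; have [l E'] := grepr_gpair c d.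
rewrite /gmul; set x := gpos (gpair a b) in E *; set y := gneg (gpair a b) in E *.
set z := gpos _ in E' *; set t := gneg _ in E' *.
transitivity (gpair (a * z + b * t) (a * t + b * z)); apply/gpairP.
  exists (k * z + k * t).
  transitivity ((x + b + k) * z + (a + y + k) * t); first by ring.
  by rewrite E -{2}E; ring.
exists (a * l + b * l).
transitivity (a * (z + d + l) + b * (c + t + l)); first by ring.
by rewrite E' -{2}E'; ring.
Qed.

Lemma gaddA : associative gadd.
Proof.
by move=> x y z; rewrite -(gpairK x) -(gpairK y) -(gpairK z) !gpairD !addrA.
Qed.

Lemma gaddC : commutative gadd.
Proof.
by move=> x y; rewrite -(gpairK x) -(gpairK y) !gpairD addrC [gneg _ + _]addrC.
Qed.

Lemma gadd0 : left_id (gpair 0 0) gadd.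
Proof. by move=> x; rewrite -(gpairK x) gpairD !add0r. Qed.

Lemma gaddN : left_inverse (gpair 0 0) gopp gadd.
Proof.
move=> x; rewrite -(gpairK x) gpairN gpairD; apply/gpairP; exists 0.
by rewrite !addr0 add0r addrC.
Qed.

HB.instance Definition _ := GRing.isZmodule.Build groth gaddA gaddC gadd0 gaddN.

Lemma gmulA : associative gmul.
Proof.
move=> x y z; rewrite -(gpairK x) -(gpairK y) -(gpairK z) !gpairM.
by congr gpair; ring.
Qed.

Lemma gmulC : commutative gmul.
Proof.
by move=> x y; rewrite -(gpairK x) -(gpairK y) !gpairM; congr gpair; ring.
Qed.

Lemma gmul1 : left_id (gpair 1 0) gmul.
Proof. by move=> x; rewrite -(gpairK x) gpairM; congr gpair; ring. Qed.

Lemma gmulDl : left_distributive gmul gadd.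
Proof.
move=> x y z; rewrite -(gpairK x) -(gpairK y) -(gpairK z) !(gpairM, gpairD).
by congr gpair; ring.
Qed.

HB.instance Definition _ :=
  GRing.Zmodule_isComPzRing.Build groth gmulA gmulC gmul1 gmulDl.

Definition groth_in (a : R) : groth := gpair a 0.

Lemma groth_in_is_nmod_morphism : nmod_morphism groth_in.
Proof. by split=> // a b; rewrite /groth_in [RHS]gpairD addr0. Qed.
HB.instance Definition _ :=
  GRing.isNmodMorphism.Build R groth groth_in groth_in_is_nmod_morphism.

Lemma groth_in_is_monoid_morphism : monoid_morphism groth_in.
Proof. by split=> // a b; rewrite /groth_in [RHS]gpairM; congr gpair; ring. Qed.
HB.instance Definition _ :=
  GRing.isMonoidMorphism.Build R groth groth_in groth_in_is_monoid_morphism.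

Definition groth_lift (V : zmodType) (f : R -> V) (x : groth) : V :=
  f (gpos x) - f (gneg x).

Section LiftAdditive.
Variables (V : zmodType) (f : {additive R -> V}).

Lemma groth_liftE a b : groth_lift f (gpair a b) = f a - f b.
Proof.
have [k /(congr1 f)] := grepr_gpair a b.
rewrite !raddfD /= => /addIr E; apply/eqP.
by rewrite /groth_lift subr_eq addrAC eq_sym subr_eq eq_sym E.
Qed.

Lemma groth_lift_in a : groth_lift f (groth_in a) = f a.
Proof. by rewrite groth_liftE raddf0 subr0. Qed.

Lemma groth_lift_is_zmod_morphism : zmod_morphism (groth_lift f).
Proof.
move=> x y; rewrite -(gpairK x) -(gpairK y).
have -> a b c d : gpair a b - gpair c d = gpair (a + d) (b + c).
  by rewrite [- _]gpairN [LHS]gpairD.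
by rewrite !groth_liftE !(raddfD f) !opprD opprK -!addrA; congr (_ + _);
   rewrite addrCA; congr (_ + _); rewrite addrC.
Qed.
HB.instance Definition _ :=
  GRing.isZmodMorphism.Build groth V (groth_lift f) groth_lift_is_zmod_morphism.

End LiftAdditive.

Section LiftRing.
Variables (A : comPzRingType) (f : {rmorphism R -> A}).

Lemma groth_lift_is_monoid_morphism : monoid_morphism (groth_lift f).
Proof.
split=> [|x y]; first by rewrite groth_liftE /= rmorph1 rmorph0 subr0.
rewrite -(gpairK x) -(gpairK y) [_ * _]gpairM !groth_liftE /= !rmorphD !rmorphM.
by ring.
Qed.
HB.instance Definition _ :=
  GRing.isMonoidMorphism.Build groth A (groth_lift f) groth_lift_is_monoid_morphism.

End LiftRing.

End Grothendieck.

Section Burnside.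
Variable S : finGroupType.
Implicit Types P : {group S}.

Definition burnside P : Type := groth (bsemi P).
HB.instance Definition _ P := GRing.ComPzRing.on (burnside P).

Local Notation AS := (burnside [set: S]%G).

Definition burnside_res P (f : {morphism P >-> S}) : AS -> burnside P :=
  groth_lift (@groth_in (bsemi P) \o semi_res f).
HB.instance Definition _ P (f : {morphism P >-> S}) :=
  GRing.RMorphism.on (burnside_res f).

Definition burnside_mark P : AS -> int := groth_lift (semi_mark P).
HB.instance Definition _ P := GRing.RMorphism.on (burnside_mark P).

(* The coefficient of [S/P]. *)
Definition burnside_coef P : AS -> int := groth_lift (semi_coef P).
HB.instance Definition _ P := GRing.Additive.on (burnside_coef P).

Section Stable.
Variable F : fusion_system S.

Definition stable : {pred AS} := fun X =>
  `[< forall P f (Ff : f \in F P [set: S]%G),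
        burnside_res [morphism of morphm (fhom_morphic Ff)] X
        = burnside_res [morphism of idm P] X >].

Lemma stable_subring : subring_closed stable.
Proof.
split=> [|X Y|X Y]; rewrite !unfold_in.
- by apply/asboolP=> P f Ff; rewrite !rmorph1.
- move=> /asboolP sX /asboolP sY; apply/asboolP=> P f Ff.
  by rewrite !rmorphB /= sX sY.
move=> /asboolP sX /asboolP sY; apply/asboolP=> P f Ff.
by rewrite !rmorphM /= sX sY.
Qed.

Record fburnside := FBurnside { fbval :> AS; _ : fbval \in stable }.
HB.instance Definition _ := [isSub for fbval].
HB.instance Definition _ := [Choice of fburnside by <:].
HB.instance Definition _ :=
  GRing.SubChoice_isSubComPzRing.Build AS stable fburnside stable_subring.

Definition fmark P (X : fburnside) : int := burnside_mark P (fbval X).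
HB.instance Definition _ P := GRing.RMorphism.copy (fmark P)
  (burnside_mark P \o (val : fburnside -> AS)).

End Stable.
End Burnside.

Section Zlocal.
Variable p : nat.

(* For p prime, this says that p does not divide the denominator of q, so that
   zlocal p is Z_(p). *)
Definition plocal : {pred rat} := fun q => coprime p `|denq q|.

Lemma plocalP q (m n : int) :
  coprime p `|n| -> q * n%:~R = m%:~R -> q \in plocal.
Proof.
move=> pn E; apply: coprime_dvdr pn.
rewrite -dvdzE -(@Gauss_dvdzr _ (numq q)); last first.
  by rewrite coprimezE coprime_sym coprime_num_den.
apply/dvdzP; exists m; apply/eqP; rewrite -(eqr_int rat) !intrM -E numqE.
by rewrite mulrAC.
Qed.

Lemma plocal_subring : subring_closed plocal.
Proof.
split=> [|x y xp yp|x y xp yp]; first by rewrite unfold_in coprimen1.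
  apply: (@plocalP _ (numq x * denq y - numq y * denq x) (denq x * denq y)).
    by rewrite abszM coprimeMr; apply/andP.
  by rewrite intrB !intrM !numqE; ring.
apply: (@plocalP _ (numq x * numq y) (denq x * denq y)).
  by rewrite abszM coprimeMr; apply/andP.
by rewrite !intrM !numqE; ring.
Qed.

Record zlocal := ZLocal { zval :> rat; _ : zval \in plocal }.
HB.instance Definition _ := [isSub for zval].
HB.instance Definition _ := [Choice of zlocal by <:].
HB.instance Definition _ :=
  GRing.SubChoice_isSubComNzRing.Build rat plocal zlocal plocal_subring.

End Zlocal.

(* The tensor product of two commutative rings over Z: the formal sums of
   pairs, two of them being identified when every biadditive map to an abelian
   group takes the same value on both. *)
Section Tensor.
Variables A B : comPzRingType.
Implicit Types s t : seq (A * B).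

Definition biadditive (M : zmodType) (b : A -> B -> M) : Prop :=
  (forall y, {morph b^~ y : a a' / a + a'}) /\
  (forall a, {morph b a : y y' / y + y'}).

Definition bisum (M : zmodType) (b : A -> B -> M) s : M :=
  \sum_(u <- s) b u.1 u.2.

Definition tensor_eq s t : bool :=
  `[< forall (M : zmodType) (b : A -> B -> M), biadditive b ->
        bisum b s = bisum b t >].

Lemma tensor_eq_equiv : equiv_class_of tensor_eq.
Proof.
split=> [s|s t|t s u]; first by apply/asboolP.
  by apply/idP/idP=> /asboolP E; apply/asboolP=> M b bb; rewrite E.
by move=> /asboolP E /asboolP E'; apply/asboolP=> M b bb; rewrite E ?E'.
Qed.

Canonical tensor_eq_canonical := EquivRelPack tensor_eq_equiv.

Definition tensor := {eq_quot tensor_eq}.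
HB.instance Definition _ := EqQuotient.on tensor.
HB.instance Definition _ := Choice.on tensor.

Definition tsum s : tensor := \pi_tensor s.
Definition trepr (x : tensor) : seq (A * B) := generic_quotient.repr x.

Definition tensor_lift (M : zmodType) (b : A -> B -> M) (x : tensor) : M :=
  bisum b (trepr x).

Lemma treprK x : tsum (trepr x) = x.
Proof. exact: reprK. Qed.

Lemma tensor_liftE (M : zmodType) (b : A -> B -> M) s :
  biadditive b -> tensor_lift b (tsum s) = bisum b s.
Proof.
move=> bb; have /eqP := treprK (tsum s).
by rewrite piE => /asboolP /(_ M b bb).
Qed.

Lemma tsumP s t : (forall (M : zmodType) (b : A -> B -> M), biadditive b ->
  bisum b s = bisum b t) -> tsum s = tsum t.
Proof. by move=> E; apply/eqP; rewrite piE; apply/asboolP. Qed.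

Lemma bisum_cat (M : zmodType) (b : A -> B -> M) s t :
  bisum b (s ++ t) = bisum b s + bisum b t.
Proof. exact: big_cat. Qed.

Lemma biadditiveN (M : zmodType) (b : A -> B -> M) a y :
  biadditive b -> b (- a) y = - b a y.
Proof.
case=> bl _; apply/eqP; rewrite -addr_eq0 -bl addNr.
by have := bl y 0 0; rewrite addr0 => /eqP; rewrite -subr_eq subrr eq_sym.
Qed.

Definition tmul_seq s t : seq (A * B) :=
  [seq (u.1 * v.1, u.2 * v.2) | u <- s, v <- t].

Lemma bisum_mul (M : zmodType) (b : A -> B -> M) s t :
  bisum b (tmul_seq s t) =
  bisum (fun a y => bisum (fun a' y' => b (a * a') (y * y')) t) s.
Proof. by rewrite /bisum big_allpairs_dep. Qed.

Lemma biadditive_mul (M : zmodType) (b : A -> B -> M) a y :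
  biadditive b -> biadditive (fun a' y' => b (a * a') (y * y')).
Proof. by case=> bl br; split=> [y' ? ?|a' ? ?]; rewrite mulrDr (bl, br). Qed.

Lemma biadditive_bisum (M : zmodType) (b : A -> B -> M) t :
  biadditive b ->
  biadditive (fun a y => bisum (fun a' y' => b (a * a') (y * y')) t).
Proof.
by case=> bl br; split=> [y ? ?|a ? ?]; rewrite /bisum -big_split /=;
  apply: eq_bigr => u _; rewrite mulrDl (bl, br).
Qed.

Lemma bisum_mulC (M : zmodType) (b : A -> B -> M) s t :
  bisum b (tmul_seq s t) = bisum b (tmul_seq t s).
Proof.
rewrite !bisum_mul /bisum exchange_big /=; apply: eq_bigr => u _.
by apply: eq_bigr => v _; rewrite mulrC [u.2 * _]mulrC.
Qed.

Definition tadd (x y : tensor) := tsum (trepr x ++ trepr y).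
Definition topp (x : tensor) := tsum [seq (- u.1, u.2) | u <- trepr x].
Definition tmul (x y : tensor) := tsum (tmul_seq (trepr x) (trepr y)).

Lemma tsumD s t : tadd (tsum s) (tsum t) = tsum (s ++ t).
Proof.
by apply: tsumP => M b bb; rewrite !bisum_cat; congr (_ + _); exact: tensor_liftE.
Qed.

Lemma tsumM s t : tmul (tsum s) (tsum t) = tsum (tmul_seq s t).
Proof.
apply: tsumP => M b bb; rewrite bisum_mul.
transitivity (bisum b (tmul_seq s (trepr (tsum t)))).
  by rewrite bisum_mul; exact: tensor_liftE (biadditive_bisum _ bb).
rewrite [LHS]bisum_mulC [RHS]bisum_mulC !bisum_mul.
exact: tensor_liftE (biadditive_bisum _ bb).
Qed.

Lemma taddA : associative tadd.
Proof.
by move=> x y z; rewrite -(treprK x) -(treprK y) -(treprK z) !tsumD catA.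
Qed.

Lemma taddC : commutative tadd.
Proof.
move=> x y; rewrite -(treprK x) -(treprK y) !tsumD; apply: tsumP => M b bb.
by rewrite !bisum_cat addrC.
Qed.

Lemma tadd0 : left_id (tsum [::]) tadd.
Proof. by move=> x; rewrite -(treprK x) tsumD. Qed.

Lemma taddN : left_inverse (tsum [::]) topp tadd.
Proof.
move=> x; rewrite -{2}(treprK x) tsumD; apply: tsumP => M b bb.
rewrite bisum_cat /bisum big_map big_nil -big_split /= big1 // => u _.
by rewrite biadditiveN // addNr.
Qed.

HB.instance Definition _ := GRing.isZmodule.Build tensor taddA taddC tadd0 taddN.

Lemma tmulC : commutative tmul.
Proof.
move=> x y; rewrite -(treprK x) -(treprK y) !tsumM; apply: tsumP => M b bb.
exact: bisum_mulC.
Qed.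

Lemma tmulA : associative tmul.
Proof.
move=> x y z; rewrite -(treprK x) -(treprK y) -(treprK z) !tsumM.
apply: tsumP => M b bb; rewrite !bisum_mul /bisum; apply: eq_bigr => u _.
rewrite big_allpairs_dep /=; apply: eq_bigr => v _; apply: eq_bigr => w _.
by rewrite !mulrA.
Qed.

Lemma tmul1 : left_id (tsum [:: (1, 1)]) tmul.
Proof.
move=> x; rewrite -(treprK x) tsumM; apply: tsumP => M b bb.
rewrite bisum_mul /bisum big_seq1; apply: eq_bigr => u _.
by rewrite !mul1r.
Qed.

Lemma tmulDl : left_distributive tmul tadd.
Proof.
move=> x y z; rewrite -(treprK x) -(treprK y) -(treprK z) !(tsumM, tsumD).
by apply: tsumP => M b bb; rewrite bisum_cat !bisum_mul -bisum_cat.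
Qed.

HB.instance Definition _ :=
  GRing.Zmodule_isComPzRing.Build tensor tmulA tmulC tmul1 tmulDl.

Definition tens (a : A) (y : B) : tensor := tsum [:: (a, y)].

Lemma tens_biadditive : biadditive tens.
Proof.
by split=> [y a a'|a y y']; rewrite /tens [RHS]tsumD; apply: tsumP => M b [bl br];
  rewrite /bisum !big_cons !big_nil !addr0 (bl, br).
Qed.

Lemma tens_mul a a' y y' : tens a y * tens a' y' = tens (a * a') (y * y').
Proof. by rewrite /tens [LHS]tsumM. Qed.

Lemma tsum_tens s : tsum s = \sum_(u <- s) tens u.1 u.2.
Proof.
elim: s => [|[a y] s IHs]; first by rewrite big_nil.
by rewrite big_cons -IHs /tens [RHS]tsumD.
Qed.

Lemma tensor_lift_is_zmod_morphism (M : zmodType) (b : A -> B -> M) :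
  biadditive b -> zmod_morphism (tensor_lift b).
Proof.
move=> bb x y; rewrite -{1}(treprK x) -{1}(treprK y).
have -> : - tsum (trepr y) = tsum [seq (- u.1, u.2) | u <- trepr y].
  by rewrite treprK.
rewrite [_ + _]tsumD tensor_liftE // bisum_cat; congr (_ + _).
rewrite /tensor_lift /bisum big_map -sumrN; apply: eq_bigr => u _.
exact: biadditiveN.
Qed.

Lemma tensor_lift_tens (M : zmodType) (b : A -> B -> M) a y :
  biadditive b -> tensor_lift b (tens a y) = b a y.
Proof. by move=> bb; rewrite tensor_liftE // /bisum big_seq1. Qed.

End Tensor.

Section LocalBurnside.
Variables (p : nat) (S : finGroupType) (F : fusion_system S).
Implicit Types P Q : {group S}.

Definition fburnside_loc : Type := tensor (zlocal p) (fburnside F).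
HB.instance Definition _ := GRing.ComPzRing.on fburnside_loc.

Definition floc (X : fburnside F) : fburnside_loc := tens 1 X.

Definition lmark_bi P (a : zlocal p) (X : fburnside F) : zlocal p :=
  a * (fmark P X)%:~R.

Lemma lmark_biadditive P : biadditive (lmark_bi P).
Proof.
split=> [X a a'|a X X']; rewrite /lmark_bi ?mulrDl //.
by rewrite (rmorphD (fmark P)) intrD mulrDr.
Qed.

(* The Z_(p)-linear extension of Phi_P. *)
Definition lmark P : fburnside_loc -> zlocal p := tensor_lift (lmark_bi P).

HB.instance Definition _ P :=
  GRing.isZmodMorphism.Build fburnside_loc (zlocal p) (lmark P)
    (tensor_lift_is_zmod_morphism (lmark_biadditive P)).

Lemma lmark_tens P a X : lmark P (tens a X) = a * (fmark P X)%:~R.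
Proof. exact: tensor_lift_tens (lmark_biadditive P). Qed.

Lemma lmark_is_monoid_morphism P : monoid_morphism (lmark P).
Proof.
split=> [|x y]; first by rewrite [LHS]lmark_tens rmorph1 mulr1.
rewrite -(treprK x) -(treprK y) !tsum_tens mulr_suml !raddf_sum mulr_suml /=.
apply: eq_bigr => u _; rewrite mulr_sumr raddf_sum mulr_sumr /=.
apply: eq_bigr => v _; rewrite tens_mul !lmark_tens rmorphM intrM.
by rewrite mulrACA.
Qed.
HB.instance Definition _ P :=
  GRing.isMonoidMorphism.Build fburnside_loc (zlocal p) (lmark P)
    (lmark_is_monoid_morphism P).

Lemma fburnside_loc_nonzero : 1 != 0 :> fburnside_loc.
Proof.
apply/eqP => /(congr1 (lmark 1%G)); rewrite rmorph1 rmorph0 => /eqP.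
by rewrite oner_eq0.
Qed.
HB.instance Definition _ :=
  GRing.PzSemiRing_isNonZero.Build fburnside_loc fburnside_loc_nonzero.

End LocalBurnside.

Section ReehBasis.
Variables (S : finGroupType) (F : fusion_system S).
Implicit Types (P Q : {group S}) (C : {set {group S}}).

(* alpha C is meaningful only for C in fclasses F. *)
Record reeh_basis (alpha : {set {group S}} -> fburnside F) : Prop := ReehBasis {
  reeh_gset : forall C, C \in fclasses F ->
    exists X : bsemi [set: S]%G, fbval (alpha C) = groth_in X;
  reeh_gen : forall X : fburnside F, exists c : {set {group S}} -> int,
    X = \sum_(C in fclasses F) alpha C *~ c C;
  reeh_free : forall c : {set {group S}} -> int,
    \sum_(C in fclasses F) alpha C *~ c C = 0 ->
    forall C, C \in fclasses F -> c C = 0;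
  reeh_coef_supp : forall P Q,
    burnside_coef Q (alpha (fclass F P)) != 0 -> fsub F Q P;
  reeh_coef_diag : forall P, fully_normalized F P ->
    burnside_coef P (alpha (fclass F P)) = 1;
  reeh_coef_off : forall P C, fully_normalized F P -> C \in fclasses F ->
    C != fclass F P -> burnside_coef P (alpha C) = 0;
  reeh_mark : forall P, fully_normalized F P ->
    fmark P (alpha (fclass F P)) = #|'N(P)%g : P|%g%:Z;
  reeh_mark_supp : forall P Q,
    (fmark Q (alpha (fclass F P)) != 0) = fsub F Q P
}.

End ReehBasis.

(* The characteristic of R is c, including c = 0. *)
Definition has_char (R : pzRingType) (c : nat) : Prop :=
  forall n : nat, (n%:R == 0 :> R) = (c %| n)%N.

Section Ideals.
Variable R : comNzRingType.
Local Open Scope classical_set_scope.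

Definition ideal_type (J : prime_idealr R) (c : nat) : Prop :=
  has_char {ideal_quot J} c.

(* The terms of type idealr R are the proper ideals. *)
Definition maximal_ideal (J : idealr R) : Prop :=
  forall I : idealr R, {subset J <= I} -> I =i J.

Definition minimal_prime (J : prime_idealr R) : Prop :=
  forall I : prime_idealr R, {subset I <= J} -> I =i J.

Definition is_ideal (I : set R) : Prop :=
  I 0 /\ forall a x y, I x -> I y -> I (a * x + y).

Definition ideal_gen (G : set R) : set R := smallest is_ideal G.

End Ideals.

Section PrimeIdeals.
Variables (p : nat) (S : finGroupType) (F : fusion_system S).
Implicit Types P Q : {group S}.
Local Open Scope classical_set_scope.
Local Notation A := (fburnside_loc p F).

Definition ideal_p : set A :=
  [set X | exists z : zlocal p, lmark [set: S]%G X = p%:R * z].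

Definition ideal_0 P : set A := [set X | lmark P X = 0].

Variable alpha : {set {group S}} -> fburnside F.

Definition gens_p : set A :=
  [set floc p (alpha (fclass F P)) | P in [set P : {group S} | P \proper [set: S]%G]]
  `|` [set floc p (alpha (fclass F [set: S]%G)) *+ p].

Definition gens_0 P : set A :=
  [set floc p (alpha (fclass F Q))
       - floc p (alpha (fclass F [set: S]%G)) *~ fmark P (alpha (fclass F Q))
  | Q in [set Q : {group S} | Q \proper [set: S]%G]].

End PrimeIdeals.

Arguments ideal_p p {S} F.
Arguments ideal_0 p {S} F P.
Arguments gens_p p {S F} alpha.
Arguments gens_0 p {S F} alpha P.

(* Main.v *)
Require Import Defs.
From HB Require Import structures.
From mathcomp Require Import boolp classical_sets.
From mathcomp Require Import all_boot all_order all_algebra.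
From mathcomp Require Import all_fingroup all_solvable.
From mathcomp Require Import ring.

(* Marks determine finite G-sets, so the marks embed A(F)_(p) in a power of
   Z_(p), and stability of an element of A(S) is constancy of its marks on
   F-classes.

   For P and Q not S-conjugate, S/P or S/Q has different marks at P and Q.
   Products of elements Y - Phi_Q(Y) built from these, followed by a product over
   the F-class of P, give a stable element whose mark vanishes exactly on that
   class. Hence J_{P,0} is contained in J_{Q,0} only if P and Q are F-isomorphic.

   Let J be a prime ideal. If each P had an x_P outside J with Phi_P(x_P) = 0,
   the product of the x_P would be 0, as all its marks vanish; hence J contains
   some J_{P,0}, with equality when p is not in J. If p is in J and x is in
   J_{S,p}, then all Phi_P(x) are divisible by p, because Phi_P and Phi_S agree
   mod p, while the product of the x - Phi_P(x) is 0; so x is in J.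

   The generators come from expanding on the basis: the marks of alpha_[P] at S
   vanish for P < S, and the coefficients at fully normalized subgroups show
   that alpha_[S] = 1. *)

Set Implicit Arguments.
Unset Strict Implicit.
Unset Printing Implicit Defensive.

Import GRing.Theory Num.Theory.
Local Open Scope ring_scope.
Local Open Scope quotient_scope.

(** * Marks determine finite G-sets *)

Section MarksDetermineSets.
Variables (S : finGroupType) (G : {group S}).
Implicit Types (T : finType) (P R : {group S}).
Local Open Scope group_scope.

Lemma astab1_act_eq T (to : action G T) x g h : g \in G -> h \in G ->
  (to x g == to x h) = (g * h^-1 \in 'C_G[x | to]).
Proof.
move=> Gg Gh; have Ggh : g * h^-1 \in G by rewrite groupM ?groupV.
rewrite !inE Ggh sub1set inE actMin ?groupV //.
by apply/eqP/eqP => [-> | E]; rewrite ?actKin // -[in RHS]E actKVin.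
Qed.

Section TwoActions.
Variables (T1 T2 : finType) (to1 : action G T1) (to2 : action G T2).

(** Two elements of [G] move [x] to the same point exactly when their quotient stabilizes [x], so a
    common stabilizer makes x.g -> y.g well defined and injective on the orbit. *)
Lemma orbit_transport x y : 'C_G[x | to1] = 'C_G[y | to2] ->
  exists2 h : T1 -> T2, {in orbit to1 G x &, injective h} &
    forall g, g \in G -> h (to1 x g) = to2 y g.
Proof.
move=> eqC.
have E g g' : g \in G -> g' \in G ->
    (to1 x g == to1 x g') = (to2 y g == to2 y g').
  by move=> Gg Gg'; rewrite !astab1_act_eq // eqC.
(* By [E] the choice of g carrying [x] to [z] is immaterial; the default 1 is reached only outside
   the orbit. *)
pose h z := to2 y (odflt 1 [pick g in G | to1 x g == z]).
have hE g : g \in G -> h (to1 x g) = to2 y g.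
  move=> Gg; rewrite /h; case: pickP => [g' /andP[Gg' /= e] | /(_ g)].
    by apply/eqP; rewrite -E.
  by rewrite Gg eqxx.
exists h => // _ _ /orbitP[g Gg <-] /orbitP[g' Gg' <-].
by rewrite !hE // => /eqP; rewrite -E // => /eqP.
Qed.

Lemma card_afix_orbit_leq x y R : R \subset G ->
  'C_G[x | to1] = 'C_G[y | to2] ->
  (#|'Fix_(orbit to1 G x | to1)(R)| <= #|'Fix_(orbit to2 G y | to2)(R)|)%N.
Proof.
move=> sRG eqC; have [h hI hE] := orbit_transport eqC.
rewrite -(card_in_imset (f := h)); last first.
  by apply: sub_in2 hI => z /setIP[].
apply/subset_leq_card/subsetP=> _ /imsetP[z /setIP[/orbitP[g Gg <-] Fz] ->].
rewrite hE // inE mem_orbit //; apply/afixP=> r Rr.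
have Gr := subsetP sRG r Rr; rewrite -actMin // -!hE ?groupM // actMin //.
by rewrite (afixP Fz).
Qed.

End TwoActions.

Lemma card_afix_orbit T1 T2 (to1 : action G T1) (to2 : action G T2) x y R :
  R \subset G -> 'C_G[x | to1] = 'C_G[y | to2] ->
  #|'Fix_(orbit to1 G x | to1)(R)| = #|'Fix_(orbit to2 G y | to2)(R)|.
Proof.
by move=> sRG eqC; apply/eqP; rewrite eqn_leq !card_afix_orbit_leq.
Qed.

Lemma sub_astab1_afix T (to : action G T) x P : P \subset G ->
  (x \in 'Fix_to(P)) = (P \subset 'C_G[x | to]).
Proof.
move=> sPG; apply/afixP/subsetP => [Fx g Pg | sPC g Pg].
  by rewrite !inE (subsetP sPG) //= sub1set inE Fx.
by have := sPC g Pg; rewrite !inE sub1set inE => /and3P[_ _ /eqP].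
Qed.

Lemma acts_orbit T (to : action G T) x : {acts G, on orbit to G x | to}.
Proof.
move=> g Gg z; apply/orbitP/orbitP => -[k Gk E].
  by exists (k * g^-1); rewrite ?groupM ?groupV // actMin ?groupV // E actKin.
by exists (k * g); rewrite ?groupM // actMin // E.
Qed.

Lemma acts_orbitD T (to : action G T) (A : {set T}) x :
  {acts G, on A | to} -> {acts G, on A :\: orbit to G x | to}.
Proof. by move=> actA g Gg z; rewrite !in_setD actA // acts_orbit. Qed.

Lemma acts_orbit_sub T (to : action G T) (A : {set T}) x :
  {acts G, on A | to} -> x \in A -> orbit to G x \subset A.
Proof. by move=> actA Ax; apply/subsetP=> _ /orbitP[g Gg <-]; rewrite actA. Qed.

Lemma card_afixD_orbit T (to : action G T) (A : {set T}) x R :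
  {acts G, on A | to} -> x \in A ->
  (#|'Fix_(A | to)(R)| = #|'Fix_(orbit to G x | to)(R)|
    + #|'Fix_(A :\: orbit to G x | to)(R)|)%N.
Proof.
move=> actA Ax; rewrite -(cardsID (orbit to G x) 'Fix_(A | to)(R)).
congr (_ + _)%N; apply: eq_card => z; rewrite !inE; last first.
  by rewrite andbA.
case Oz: (z \in orbit to G x); last by rewrite andbF.
by rewrite (subsetP (acts_orbit_sub actA Ax)) ?andbT.
Qed.

Section PartialIso.
Variables (T1 T2 : finType) (to1 : action G T1) (to2 : action G T2).

(* Match an orbit of maximal stabilizer order in A with one in B, and recurse on
   the complements. *)
Lemma marks_partial_iso (y0 : T2) (A : {set T1}) (B : {set T2}) :
  {acts G, on A | to1} -> {acts G, on B | to2} ->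
  (forall P, P \subset G -> #|'Fix_(A | to1)(P)| = #|'Fix_(B | to2)(P)|) ->
  exists f : T1 -> T2, [/\ {in A &, injective f}, {in A, forall x, f x \in B}
    & {in A & G, forall x g, f (to1 x g) = to2 (f x) g}].
Proof.
have [n] := ubnP #|A|; elim: n A B => // n IHn A B leAn actA actB eqAB.
have [-> | [x0 Ax0]] := set_0Vmem A.
  by exists (fun=> y0); split=> [x|x|x]; rewrite inE.
have [x Ax maxx] := arg_maxnP (fun x => #|'C_G[x | to1]|) Ax0.
set P := 'C_G[x | to1]%G.
have sPG : P \subset G := subsetIl _ _.
(* [P] has a fixed point in [A], namely [x], hence also one in [B]. *)
have [y /setIP[By Fy]] : exists y, y \in 'Fix_(B | to2)(P).
  apply/set0Pn; rewrite -card_gt0 -eqAB // card_gt0; apply/set0Pn; exists x.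
  by rewrite in_setI [x \in A]Ax sub_astab1_afix ?subxx.
(* The stabilizer of [y] contains [P]; it fixes a point of [A] in turn, so by the maximal choice of
   [x] it is no larger than [P]. *)
have eqC : 'C_G[x | to1] = 'C_G[y | to2].
  apply/eqP; rewrite eqEcard -sub_astab1_afix // Fy /=.
  set Q := 'C_G[y | to2]%G; have sQG : Q \subset G := subsetIl _ _.
  have [x' /setIP[Ax' Fx']] : exists x', x' \in 'Fix_(A | to1)(Q).
    apply/set0Pn; rewrite -card_gt0 eqAB // card_gt0; apply/set0Pn; exists y.
    by rewrite in_setI By sub_astab1_afix ?subxx.
  apply: leq_trans (maxx _ Ax').
  by apply: subset_leq_card; rewrite -sub_astab1_afix.
have [h hI hE] := orbit_transport eqC.
have sOB : orbit to2 G y \subset B := acts_orbit_sub actB By.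
have [||||f [fI fB fM]] := IHn (A :\: orbit to1 G x) (B :\: orbit to2 G y).
- rewrite -ltnS; apply: leq_trans leAn; rewrite ltnS; apply: proper_card.
  rewrite properE subsetDl; apply/subsetPn; exists x => //.
  by rewrite inE orbit_refl.
- exact: acts_orbitD.
- exact: acts_orbitD.
- move=> R sRG; apply/eqP; rewrite -(eqn_add2l #|'Fix_(orbit to1 G x | to1)(R)|).
  rewrite -card_afixD_orbit // eqAB // (card_afix_orbit sRG eqC).
  by rewrite -card_afixD_orbit.
have hO z : z \in orbit to1 G x -> h z \in orbit to2 G y.
  by case/orbitP=> g Gg <-; rewrite hE // mem_orbit.
have fO z : z \in A -> z \notin orbit to1 G x -> f z \notin orbit to2 G y.
  move=> Az nOz; have : z \in A :\: orbit to1 G x by rewrite inE nOz.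
  by case/fB/setDP.
exists (fun z => if z \in orbit to1 G x then h z else f z); split.
- move=> u v Au Av; case: ifPn => Ou; case: ifPn => Ov.
  + exact: hI.
  + by move=> E; case/negP: (fO v Av Ov); rewrite -E hO.
  + by move=> E; case/negP: (fO u Au Ou); rewrite E hO.
  + by apply: fI; rewrite inE ?Ou ?Ov.
- move=> z Az; case: ifPn => Oz; first exact: (subsetP sOB _ (hO _ Oz)).
  by have /fB/setDP[] : z \in A :\: orbit to1 G x by rewrite inE Oz.
move=> z g Az Gg; have := acts_orbit to1 x Gg z => ->.
case: ifPn => [/orbitP[k Gk <-] | Oz].
  by rewrite -actMin // !hE ?groupM // actMin.
by apply: fM => //; rewrite inE Oz.
Qed.

(** The marks at the trivial subgroup compare cardinalities, which turns the equivariant injection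
    into a bijection. *)
Lemma marks_act_iso :
  (forall P, P \subset G -> act_mark P to1 = act_mark P to2) -> act_iso to1 to2.
Proof.
move=> eqm; have eqF P : P \subset G ->
    #|'Fix_([set: T1] | to1)(P)| = #|'Fix_([set: T2] | to2)(P)|.
  by move=> sPG; rewrite !setTI; apply/eqP; rewrite -eqz_nat; apply/eqP/eqm.
have actT T (to : action G T) : {acts G, on [set: T] | to}.
  by move=> g _ z; rewrite !inE.
have fix1 T (to : action G T) : 'Fix_([set: T] | to)(1%G) = setT.
  by rewrite setTI; apply/setP=> z; rewrite sub_astab1_afix ?sub1G ?inE.
have eqT : #|T1| = #|T2| by have := eqF 1%G (sub1G G); rewrite !fix1 !cardsT.
(* A point [y0] of the target is needed to make the map total, so the empty case is treated
   apart. *)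
case: (pickP (mem T2)) => [y0 _ | T20].
  have [f [fI _ fM]] := marks_partial_iso y0 (actT _ to1) (actT _ to2) eqF.
  exists f; last by move=> x g Gg; apply: fM.
  by apply: inj_card_bij; rewrite ?eqT // => x y; apply: fI.
have T20F : T2 -> False by move=> y; have := T20 y.
have T10F : T1 -> False.
  move=> x; have : (0 < #|T1|)%N by apply/card_gt0P; exists x.
  by rewrite eqT eq_card0.
exists (fun x => match T10F x with end); last by move=> x; case: (T10F x).
exists (fun y => match T20F y with end); first by move=> x; case: (T10F x).
by move=> y; case: (T20F y).
Qed.

End PartialIso.

Lemma bsemi_mark_inj (X Y : bsemi G) :
  (forall P, P \subset G -> semi_mark P X = semi_mark P Y) -> X = Y.
Proof.
by move=> eqXY; rewrite -(breprK X) -(breprK Y); apply/bclassP/marks_act_iso.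
Qed.

End MarksDetermineSets.

(** * Stable elements *)

Section Marks.
Variable S : finGroupType.
Implicit Types P Q R G : {group S}.

Lemma act_mark_sum G P (T1 T2 : finType) (to1 : action G T1) (to2 : action G T2) :
  act_mark P (sum_act to1 to2) = act_mark P to1 + act_mark P to2.
Proof.
rewrite /act_mark -PoszD -!sum1_card big_sumType /=; congr (Posz (_ + _)%N);
  apply: eq_bigl => x; apply/afixP/afixP => Fx g Pg;
  by [have [] := Fx g Pg | rewrite /= Fx].
Qed.

(** The additive structure put on [semi_mark] concerns actions of the whole of [S]; restrictions to
    a subgroup call for an arbitrary [G]. *)
Lemma semi_markD G P (X Y : bsemi G) : P \subset G ->
  semi_mark P (X + Y) = semi_mark P X + semi_mark P Y.
Proof.
move=> sPG; rewrite -(breprK X) -(breprK Y) bclass_add !semi_mark_bclass //.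
exact: act_mark_sum.
Qed.

Lemma burnside_mark_pair P (a b : bsemi [set: S]%G) :
  burnside_mark P (gpair a b) = semi_mark P a - semi_mark P b.
Proof. exact: groth_liftE. Qed.

(** Moving negative parts across gives an equality of marks of actual S-sets, which are then
    isomorphic; so the extra summand of the Grothendieck relation can be 0. *)
Lemma burnside_mark_inj (X Y : burnside [set: S]%G) :
  (forall P, burnside_mark P X = burnside_mark P Y) -> X = Y.
Proof.
rewrite -(gpairK X) -(gpairK Y) => eqXY; apply/gpairP; exists 0.
rewrite !addr0; apply: bsemi_mark_inj => P _; rewrite !semi_markD ?subsetT //.
have /eqP := eqXY P; rewrite !burnside_mark_pair subr_eq addrAC eq_sym subr_eq.
by move/eqP.
Qed.

Lemma semi_mark_res P R (f : {morphism P >-> S}) (X : bsemi [set: S]%G) :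
  R \subset P -> semi_mark R (semi_res f X) = semi_mark (f @* R)%G X.
Proof.
move=> sRP; rewrite -(breprK X) semi_res_bclass !semi_mark_bclass ?subsetT //.
congr Posz; apply: eq_card => x; apply/afixP/afixP => Fx g /= Rg.
  by case/morphimP: Rg => r Pr Rr ->; exact: Fx.
by apply: Fx; rewrite mem_morphim // (subsetP sRP).
Qed.

Lemma burnside_res_pair P (f : {morphism P >-> S}) (a b : bsemi [set: S]%G) :
  burnside_res f (gpair a b) = gpair (semi_res f a) (semi_res f b).
Proof.
rewrite [LHS]groth_liftE /= /groth_in [- _]gpairN [LHS]gpairD.
by rewrite addr0 add0r.
Qed.

(** Marks detect equality in A(P), and the mark at [R] of the restriction along [f] is the mark of
    [X] at f(R). *)
Lemma burnside_res_eqP P (f g : {morphism P >-> S}) (X : burnside [set: S]%G) :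
  burnside_res f X = burnside_res g X <->
  (forall R, R \subset P ->
     burnside_mark (f @* R)%G X = burnside_mark (g @* R)%G X).
Proof.
rewrite -(gpairK X); move: (gpos X) (gneg X) => a b.
rewrite !burnside_res_pair; split=> [/gpairP[k E] R sRP | E].
  apply/eqP; rewrite !burnside_mark_pair subr_eq addrAC eq_sym subr_eq.
  move/(congr1 (semi_mark R)): E; rewrite !semi_markD // !semi_mark_res //.
  by move/addIr ->.
apply/gpairP; exists 0; rewrite !addr0; apply: bsemi_mark_inj => R sRP.
rewrite !semi_markD // !semi_mark_res //; apply/eqP.
have /eqP := E R sRP; rewrite !burnside_mark_pair subr_eq addrAC eq_sym subr_eq.
by rewrite eq_sym.
Qed.

End Marks.

(** * F-isomorphism, and stability as constancy of marks on classes *)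

Section Isomorphism.
Variables (S : finGroupType) (F : fusion_system S).
Implicit Types P Q R : {group S}.
Local Open Scope group_scope.

Lemma fhom_incl P Q : P \subset Q -> conj_ffun P 1 \in F P Q.
Proof.
move=> sPQ; apply: fhom_conj => x Px.
by rewrite mul1g invg1 mulg1 (subsetP sPQ).
Qed.

Lemma conj_ffun1 P x : x \in P -> conj_ffun P 1 x = x.
Proof. by move=> Px; rewrite ffunE Px mul1g invg1 mulg1. Qed.

Lemma fhom_in P Q f x : f \in F P Q -> x \in P -> f x \in Q.
Proof. by move=> /fhom_on /pffun_onP[_ fQ] Px; apply: fQ; exact: image_f. Qed.

Lemma fhom_fiso P Q f : f \in F P Q -> f @: P = Q -> fiso F P Q f.
Proof.
move=> fPQ imf; have [_ [g gQP fK]] := fhom_img fPQ imf.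
rewrite /fiso fPQ; apply/exists_inP; exists g => //.
apply/andP; split; apply/forall_inP => x; first by move/fK->.
by rewrite -imf => /imsetP[y Py ->]; rewrite fK.
Qed.

Lemma fiso_img P Q f : fiso F P Q f -> f @: P = Q.
Proof.
case/andP=> fPQ /exists_inP[g gQP /andP[_ /forall_inP gK]].
apply/setP=> y; apply/imsetP/idP => [[x Px ->] | Qy]; first exact: fhom_in Px.
by exists (g y); [exact: fhom_in Qy | rewrite (eqP (gK y Qy))].
Qed.

Lemma fisog_refl P : fisog F P P.
Proof.
apply/existsP; exists (conj_ffun P 1); apply: fhom_fiso; first exact: fhom_incl.
rewrite -[RHS]imset_id; apply: eq_in_imset => x; exact: conj_ffun1.
Qed.

Lemma fisog_sym P Q : fisog F P Q -> fisog F Q P.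
Proof.
case/existsP=> f /andP[fPQ /exists_inP[g gQP /andP[gK fK]]].
apply/existsP; exists g; rewrite /fiso gQP; apply/exists_inP; exists f => //.
by rewrite fK.
Qed.

Lemma fisog_trans P Q R : fisog F P Q -> fisog F Q R -> fisog F P R.
Proof.
case/existsP=> f fPQ /existsP[g gQR]; apply/existsP; exists [ffun x => g (f x)].
apply: fhom_fiso; first by case/andP: fPQ gQR => + _ /andP[+ _]; exact: fhom_comp.
rewrite -(fiso_img gQR) -(fiso_img fPQ) -imset_comp.
by apply: eq_imset => x; rewrite ffunE.
Qed.

Lemma fclass_eqP P Q : reflect (fclass F P = fclass F Q) (fisog F P Q).
Proof.
apply: (iffP idP) => [PQ | /setP/(_ Q)]; last by rewrite !inE fisog_refl => ->.
apply/setP=> R; rewrite !inE; apply/idP/idP; apply: fisog_trans => //.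
exact: fisog_sym.
Qed.

Lemma fisog_conj P s : fisog F P (P :^ s)%G.
Proof.
(* [P :^ s] consists of the s^-1 x s, while [conj_ffun] sends x to s x s^-1; hence the inverse. *)
apply/existsP; exists (conj_ffun P s^-1); apply: fhom_fiso.
  by apply: fhom_conj => x Px; rewrite invgK -mulgA memJ_conjg.
by apply: eq_in_imset => x Px; rewrite ffunE Px invgK -mulgA.
Qed.

Lemma fisog_morphim P R f (Ff : f \in F P [set: S]%G) : R \subset P ->
  fisog F R (morphm (fhom_morphic Ff) @* R)%G.
Proof.
move=> sRP; pose g := [ffun x => f (conj_ffun R 1 x)].
have gR : g \in F R [set: S]%G by apply: fhom_comp Ff; exact: fhom_incl.
have imR : g @: R = (morphm (fhom_morphic Ff) @* R)%G.
  rewrite /= morphimEsub //; apply: eq_in_imset => x Rx.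
  by rewrite ffunE conj_ffun1.
apply/existsP; exists g; apply: fhom_fiso => //.
by have [] := fhom_img gR imR.
Qed.

(** If [X] is stable, apply stability to an isomorphism P -> Q followed by the inclusion of [Q] in
    [S], and compare marks at [P]. Conversely, each f(R) is F-isomorphic to [R], so the two
    restrictions have equal marks. *)
Lemma stableP (X : burnside [set: S]%G) :
  reflect (forall P Q, fisog F P Q -> burnside_mark P X = burnside_mark Q X)
    (X \in Defs.stable F).
Proof.
rewrite unfold_in /Defs.stable.
apply: (iffP (asboolP _)) => [sX P Q /existsP[f isof] | eqX P f Ff].
  pose g := [ffun x => conj_ffun Q 1 (f x)].
  have [fPQ _] := andP isof.
  have gP : g \in F P [set: S]%G.
    by apply: fhom_comp fPQ _; apply: fhom_incl; exact: subsetT.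
  have /burnside_res_eqP/(_ P (subxx _)) := sX P g gP.
  have -> : ([morphism of idm P] @* P)%G = P.
    by apply: val_inj; rewrite /= morphim_idm.
  suff -> : ([morphism of morphm (fhom_morphic gP)] @* P)%G = Q by [].
  apply: val_inj; rewrite /= morphimEsub //= -(fiso_img isof).
  by apply: eq_in_imset => x Px; rewrite [LHS]ffunE conj_ffun1 ?(fhom_in fPQ).
apply/burnside_res_eqP => R sRP.
have -> : ([morphism of idm P] @* R)%G = R.
  by apply: val_inj; rewrite /= morphim_idm.
by apply/esym/eqX; exact: fisog_morphim.
Qed.

End Isomorphism.

(** * Elements separating classes *)

Section Separation.
Variable S : finGroupType.
Implicit Types P Q R : {group S}.

(* The action is trivial outside the set of cosets, which adds the same constant
   to all marks. *)
Definition coset_gset P : burnside [set: S]%G :=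
  groth_in (bclass <[actsRs_rcosets P [set: S]%G]>%act).

Lemma coset_gset_mark P Q : burnside_mark Q (coset_gset P) =
  (#|~: rcosets P [set: S]| + #|'Fix_(rcosets P [set: S] | 'Rs)(Q)%g|)%N%:Z.
Proof.
rewrite [LHS]groth_lift_in /= semi_mark_bclass ?subsetT //; congr Posz.
rewrite afix_actby setTI -[_ :|: _]setTI -(setUCr (rcosets P [set: S])).
rewrite [_ :|: ~: _]setUC -setUIr cardsU.
rewrite [X in (_ - X)%N](_ : _ = 0%N) ?subn0 //.
by apply/eqP; rewrite cards_eq0 setIA [~: _ :&: _]setIC setICr set0I.
Qed.

(** [P] fixes the coset [P] itself, so [Q] fixes some coset Px, which means that [Q] lies in
    [P :^ x]. *)
Lemma coset_gset_sub P Q :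
  burnside_mark P (coset_gset P) = burnside_mark Q (coset_gset P) ->
  exists x, (Q \subset P :^ x)%g.
Proof.
rewrite !coset_gset_mark => /eqP; rewrite eqz_nat eqn_add2l => /eqP E.
have : (0 < #|'Fix_(rcosets P [set: S] | 'Rs)(P)%g|)%N.
  apply/card_gt0P; exists (P :* 1)%g.
  rewrite in_setI sub_afixRs_norms conjsg1 subxx andbT.
  by apply/rcosetsP; exists 1%g; rewrite ?inE.
rewrite E => /card_gt0P[_ /setIP[/rcosetsP[x _ ->]]].
by rewrite sub_afixRs_norms; exists x.
Qed.

(** If neither coset space told them apart, each subgroup would lie in a conjugate of the other, and
    comparing orders would make them conjugate. *)
Lemma burnside_mark_separate P Q : (forall x, Q != P :^ x :> {set S})%g ->
  exists Y : burnside [set: S]%G, burnside_mark P Y != burnside_mark Q Y.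
Proof.
move=> ncPQ; case: (eqVneq (burnside_mark P (coset_gset P))
  (burnside_mark Q (coset_gset P))) => [/coset_gset_sub[x sQP]|]; last first.
  by exists (coset_gset P).
exists (coset_gset Q); apply: contra (ncPQ x) => /eqP/esym/coset_gset_sub[y sPQ].
by rewrite eqEcard sQP cardJg -(cardJg Q y) subset_leq_card.
Qed.

(** Multiply the Y - Phi_Q(Y) over all [Q] not conjugate to [P], where Y separates [P] from [Q]:
    each factor vanishes at its [Q] and not at [P]. *)
Lemma burnside_mark_isolate P : exists2 Z : burnside [set: S]%G,
  burnside_mark P Z != 0
  & forall Q, (forall x, Q != P :^ x :> {set S})%g -> burnside_mark Q Z = 0.
Proof.
pose nc Q := [forall x, Q != P :^ x :> {set S}]%g.
have /fin_all_exists[Y YP] Q : exists Y : burnside [set: S]%G,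
    nc Q -> burnside_mark P Y != burnside_mark Q Y.
  case: (boolP (nc Q)) => [/forallP/burnside_mark_separate[Y] | _].
    by exists Y.
  by exists 0.
exists (\prod_(Q | nc Q) (Y Q - (burnside_mark Q (Y Q))%:~R)) => [|Q /forallP ncQ].
  rewrite rmorph_prod; apply/prodf_neq0 => Q ncQ.
  by rewrite rmorphB rmorph_int intz subr_eq0 YP.
rewrite rmorph_prod (bigD1 Q) //=.
by rewrite rmorphB rmorph_int intz subrr mul0r.
Qed.

Variable F : fusion_system S.

Lemma fmark_fisog P Q (X : fburnside F) : fisog F P Q -> fmark P X = fmark Q X.
Proof. by move: P Q; apply/stableP; case: X. Qed.

Lemma fmark_separate P :
  exists X : fburnside F, forall Q, (fmark Q X == 0) = fisog F P Q.
Proof.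
have /fin_all_exists2[Z ZR Z0] := burnside_mark_isolate.
(* The factor at [R] vanishes at [R] and has the constant mark Phi_R(Z_R) at subgroups not conjugate
   to [R]. So the marks of [U] are 0 on the class of [P] and one nonzero constant elsewhere, which
   makes [U] stable. *)
pose U : burnside [set: S]%G :=
  \prod_(R in fclass F P) ((burnside_mark R (Z R))%:~R - Z R).
have UE Q : burnside_mark Q U = if fisog F P Q then 0 else
    \prod_(R in fclass F P) burnside_mark R (Z R).
  rewrite rmorph_prod; case: ifPn => PQ.
    by rewrite (bigD1 Q) ?inE //= rmorphB rmorph_int intz subrr mul0r.
  apply: eq_bigr => R; rewrite inE => PR.
  rewrite rmorphB rmorph_int intz /= (Z0 R Q) ?subr0 // => x.
  apply: contraNneq PQ => eqQ; apply: fisog_trans PR _.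
  suff -> : Q = (R :^ x)%G by exact: fisog_conj.
  exact: val_inj.
have sU : U \in Defs.stable F.
  apply/stableP => Q R QR; rewrite !UE.
  suff -> : fisog F P Q = fisog F P R by [].
  by apply/idP/idP => [PQ|]; [|move: (fisog_sym QR) => RQ PR];
    apply: fisog_trans; eassumption.
exists (FBurnside sU) => Q; rewrite [fmark _ _]UE.
case: ifP => // _; apply/negbTE/prodf_neq0 => R _; exact: ZR.
Qed.

End Separation.

(** * The localized ring *)

Section MarkCongruence.
Variables (p : nat) (S : finGroupType).
Hypothesis pS : (p.-group [set: S])%g.
Implicit Types P : {group S}.

(** Each subgroup is a p-group, so its number of fixed points is congruent mod p to the size of the
    set, the same for all subgroups. *)
Lemma semi_mark_mod P (X : bsemi [set: S]%G) :
  (semi_mark P X = semi_mark [set: S]%G X %[mod p])%Z.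
Proof.
have fixE Q :
    (semi_mark Q X = #|'I_(gset_card (generic_quotient.repr X))| %[mod p])%Z.
  have actT : [acts Q, on setT | brepr X]%g.
    by apply/subsetP=> g Qg; rewrite !inE; apply/subsetP=> x; rewrite !inE.
  have := pgroup_fix_mod (pgroupS (subsetT Q) pS) actT.
  by rewrite cardsT setTI => E; rewrite [LHS]modz_nat [RHS]modz_nat E.
by rewrite !fixE.
Qed.

Lemma burnside_mark_mod P (X : burnside [set: S]%G) :
  exists k : int, burnside_mark P X = burnside_mark [set: S]%G X + p%:Z * k.
Proof.
rewrite -(gpairK X) !burnside_mark_pair.
have dvdm (Y : bsemi [set: S]%G) : (p %| semi_mark P Y - semi_mark [set: S]%G Y)%Z.
  by rewrite -eqz_mod_dvd; apply/eqP; exact: semi_mark_mod.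
have /dvdzP[k /eqP] := dvdm (gpos X); rewrite subr_eq => /eqP ->.
have /dvdzP[l /eqP] := dvdm (gneg X); rewrite subr_eq => /eqP ->.
by exists (k - l); ring.
Qed.

End MarkCongruence.

(** * Units and divisibility by p in Z_(p) *)

Section ZlocalTheory.
Variable p : nat.
Hypothesis p_pr : prime p.

Lemma zlocal_eq_int (m : int) : (m%:~R == 0 :> zlocal p) = (m == 0).
Proof. by rewrite -(inj_eq val_inj) rmorph_int rmorph0 intr_eq0. Qed.

Lemma zlocal_mulIf (a b : zlocal p) : a * b = 0 -> a = 0 \/ b = 0.
Proof.
move/(congr1 val); rewrite rmorphM rmorph0 => /eqP; rewrite mulf_eq0.
by case/orP=> /eqP E; [left | right]; apply: val_inj; rewrite E rmorph0.
Qed.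

Lemma zlocal_inv (n : int) : coprime p `|n| ->
  exists u : zlocal p, u * n%:~R = 1.
Proof.
move=> pn; have n0 : n%:~R != 0 :> rat.
  rewrite intr_eq0; apply: contraTneq pn => ->.
  by rewrite /coprime gcdn0; case: p p_pr => [|[]].
have up : n%:~R^-1 \in plocal p.
  by apply: (@plocalP p _ 1 n) => //; rewrite mulVf.
by exists (ZLocal up); apply: val_inj; rewrite rmorphM rmorph_int rmorph1 /= mulVf.
Qed.

Lemma zlocal_frac (a : zlocal p) : exists n m : int, exists2 u : zlocal p,
  u * n%:~R = 1 & a = u * m%:~R.
Proof.
have [u uK] := zlocal_inv (valP a).
exists (denq (val a)), (numq (val a)), u => //.
have <- : a * (denq (val a))%:~R = (numq (val a))%:~R.
  by apply: val_inj; rewrite rmorphM !rmorph_int numqE.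
by rewrite mulrCA uK mulr1.
Qed.

(** Z_(p) is local: once the unit [u] is factored out there remains an integer [m], either coprime
    to p or divisible by it. *)
Lemma zlocal_unit_or_dvd (a : zlocal p) :
  (exists u, u * a = 1) \/ (exists z, a = p%:R * z).
Proof.
have [n [m [u uK ->]]] := zlocal_frac a.
case: (boolP (coprime p `|m|)) => [/zlocal_inv[v vK] | ].
  left; exists (n%:~R * v); transitivity ((u * n%:~R) * (v * m%:~R)); first by ring.
  by rewrite uK vK mulr1.
rewrite prime_coprime // negbK => pm; right.
have /dvdzP[k ->] : (p %| m)%Z by rewrite dvdzE.
by exists (u * k%:~R); rewrite intrM -pmulrn; ring.
Qed.

Lemma zlocal_p_not_unit (z : zlocal p) : p%:R * z != 1.
Proof.
apply/eqP => /(congr1 val); rewrite rmorphM rmorph_nat rmorph1 => E.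
have : (p%:Z * numq (val z) = denq (val z)).
  apply/eqP; rewrite -(eqr_int rat) intrM numqE mulrA.
  by rewrite [_%:~R * _]E mul1r.
move=> D; have := valP z; rewrite unfold_in prime_coprime // -D abszM.
by rewrite dvdn_mulr.
Qed.

End ZlocalTheory.

(** * Scalars, fractions and marks in the localized ring *)

Section LocalTheory.
Variables (p : nat) (S : finGroupType) (F : fusion_system S).
Hypothesis p_pr : prime p.
Implicit Types P Q : {group S}.
Local Notation A := (fburnside_loc p F).

(** The structure map of the Z_(p)-algebra [A]. *)
Definition lscal (a : zlocal p) : A := tens a 1.

Lemma lscal_is_zmod_morphism : zmod_morphism lscal.
Proof.
have tb := tens_biadditive (zlocal p) (fburnside F) => a b.
by rewrite /lscal tb.1 (biadditiveN _ _ tb).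
Qed.
HB.instance Definition _ :=
  GRing.isZmodMorphism.Build (zlocal p) A lscal lscal_is_zmod_morphism.

Lemma lscal_is_monoid_morphism : monoid_morphism lscal.
Proof. by split=> // a b; rewrite [RHS]tens_mul mulr1. Qed.
HB.instance Definition _ :=
  GRing.isMonoidMorphism.Build (zlocal p) A lscal lscal_is_monoid_morphism.

Lemma floc_is_nmod_morphism : nmod_morphism (@floc p S F).
Proof.
have flocD := (tens_biadditive (zlocal p) (fburnside F)).2 1.
split; last exact: flocD.
by apply: (@addrI _ (floc p 0)); rewrite -[LHS]flocD !addr0.
Qed.
HB.instance Definition _ :=
  GRing.isNmodMorphism.Build (fburnside F) A (@floc p S F) floc_is_nmod_morphism.

Lemma floc_is_monoid_morphism : monoid_morphism (@floc p S F).
Proof. by split=> // a b; rewrite [RHS]tens_mul mulr1. Qed.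
HB.instance Definition _ :=
  GRing.isMonoidMorphism.Build (fburnside F) A (@floc p S F) floc_is_monoid_morphism.

Lemma tens_lscal a X : tens a X = lscal a * floc p X :> A.
Proof. by rewrite [RHS]tens_mul mul1r mulr1. Qed.

Lemma lscal_int (m : int) X : lscal m%:~R * floc p X = floc p (X *~ m).
Proof. by rewrite rmorph_int mulrzl raddfMz. Qed.

Lemma flocD_mulz (k m : int) X Y :
  floc p (Y *~ m + X *~ k) = lscal m%:~R * floc p Y + lscal k%:~R * floc p X.
Proof. by rewrite !lscal_int raddfD. Qed.

Lemma lmark_scal P a : lmark P (lscal a) = a.
Proof. by rewrite [LHS]lmark_tens rmorph1 mulr1. Qed.

Lemma lmark_floc P X : lmark P (@floc p S F X) = (fmark P X)%:~R.
Proof. by rewrite [LHS]lmark_tens mul1r. Qed.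

Lemma lmark_scal_floc P a X : lmark P (lscal a * floc p X) = a * (fmark P X)%:~R.
Proof. by rewrite -tens_lscal lmark_tens. Qed.

(** A finite sum of tensors has a common denominator, a unit of Z_(p). This reduces statements on
    marks to A(F). *)
Lemma floc_frac (x : A) : exists (n : int) (u : zlocal p) (X : fburnside F),
  u * n%:~R = 1 /\ x = lscal u * floc p X.
Proof.
rewrite -(treprK x) tsum_tens; elim: (trepr x) => [|[a Y] s [n [u [X [uK E]]]]].
  by exists 1, 1, 0; rewrite big_nil mulr1 rmorph0 mulr0.
have [k [m [v vK ->]]] := zlocal_frac p_pr a.
(* (m/k) Y + (1/n) X has numerator mn Y + k X over the denominator kn. *)
exists (k * n), (v * u), (Y *~ (m * n) + X *~ k); split.
  by rewrite intrM mulrACA vK uK mulr1.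
rewrite big_cons E /= tens_lscal flocD_mulz mulrDr !mulrA -!rmorphM.
congr (lscal _ * _ + lscal _ * _).
  transitivity (v * m%:~R * (u * n%:~R)); first by rewrite uK mulr1.
  by rewrite intrM; ring.
by transitivity (u * (v * k%:~R)); [rewrite vK mulr1 | ring].
Qed.

Lemma lmark_inj (x y : A) : (forall P, lmark P x = lmark P y) -> x = y.
Proof.
move=> eqxy; apply/eqP; rewrite -subr_eq0.
have : forall P, lmark P (x - y) = 0 by move=> P; rewrite rmorphB /= eqxy subrr.
have [n [u [X [uK ->]]]] := floc_frac (x - y) => X0.
suff -> : X = 0 by rewrite rmorph0 mulr0.
apply: val_inj; apply: burnside_mark_inj => P; rewrite rmorph0; apply/eqP.
have /(congr1 ( *%R n%:~R)) := X0 P; rewrite lmark_scal_floc.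
by rewrite mulrA [_ * u]mulrC uK mul1r mulr0 => /eqP; rewrite zlocal_eq_int.
Qed.

Lemma lmark_fclass P Q : fclass F P = fclass F Q ->
  @lmark p S F P =1 lmark Q.
Proof.
move=> /fclass_eqP PQ x; have [n [u [X [_ ->]]]] := floc_frac x.
by rewrite !lmark_scal_floc (fmark_fisog _ PQ).
Qed.

Lemma lmark_separate P Q : (forall x : A, lmark P x = 0 -> lmark Q x = 0) ->
  fclass F P = fclass F Q.
Proof.
have [X XP] := fmark_separate F P => /(_ (floc p X)).
rewrite !lmark_floc => PQ; apply/fclass_eqP; rewrite -XP -(@zlocal_eq_int p).
by apply/eqP/PQ/eqP; rewrite zlocal_eq_int XP fisog_refl.
Qed.

Lemma lmark_mod P (x : A) : (p.-group [set: S])%g ->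
  exists z, lmark P x = lmark [set: S]%G x + p%:R * z.
Proof.
move=> pS; have [n [u [X [_ ->]]]] := floc_frac x.
rewrite !lmark_scal_floc.
have [k kE] := burnside_mark_mod pS P (val X).
exists (u * k%:~R); rewrite [fmark P X]kE rmorphD rmorphM /= -pmulrn.
by rewrite mulrDr mulrCA.
Qed.

(** The mark at [P] kills the factor indexed by [P], and the marks are jointly injective. *)
Lemma prod_lmark_eq0 (x : {group S} -> A) : (forall P, lmark P (x P) = 0) ->
  \prod_P x P = 0.
Proof.
move=> x0; apply: lmark_inj => P; rewrite rmorph0 rmorph_prod (bigD1 P) //=.
by rewrite x0 mul0r.
Qed.

End LocalTheory.

(** * Prime ideals *)

Section IdealTheory.
Variable R : comNzRingType.
Local Open Scope classical_set_scope.
Implicit Types (I G : set R) (J : prime_idealr R).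

Lemma prime_ideal_exists I : is_ideal I -> ~ I 1 ->
  (forall u v, I (u * v) -> I u \/ I v) ->
  exists J : prime_idealr R, [set` J] = I.
Proof.
move=> [I0 Il] I1 Ip; pose B : R -> bool := fun x => `[< I x >].
have Bcl : idealr_closed B.
  split; [exact/asboolP | exact/asboolP |].
  by move=> a x y /asboolP Ix /asboolP Iy; apply/asboolP/Il.
have Bp : prime_idealr_closed B.
  by move=> u v /asboolP/Ip[] Iu; apply/orP; [left | right]; apply/asboolP.
pose J : prime_idealr R :=
  HB.pack B (isIdealr.Build R B Bcl) (isPrimeIdealrClosed.Build R B Bp).
by exists J; apply/seteqP; split=> x /=; rewrite unfold_in /= => /asboolP.
Qed.

Lemma eq_idealr J J' : [set` J] = [set` J'] -> J =i J'.
Proof.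
by move/seteqP=> [sJJ' sJ'J] x; apply/idP/idP; [exact: sJJ' | exact: sJ'J].
Qed.

Lemma ideal_typeP J c : ideal_type J c <-> forall n, (n%:R \in J) = (c %| n)%N.
Proof.
suff E n : (n%:R == 0 :> {ideal_quot J}) = (n%:R \in J).
  by split=> Jc n; [rewrite -E | rewrite E].
rewrite -[n%:R in RHS]subr0 Quotient.idealrBE -(rmorph_nat (\pi_{ideal_quot J})).
by rewrite -(rmorph0 (\pi_{ideal_quot J})).
Qed.

Lemma prime_idealr_prod (T : finType) J (x : T -> R) :
  \prod_i x i \in J -> exists i, x i \in J.
Proof.
suff H (s : seq T) : \prod_(i <- s) x i \in J -> exists i, x i \in J by exact: H.
elim: s => [|i s IHs]; first by rewrite big_nil idealr1.
by rewrite big_cons prime_idealrM => /orP[Ji | /IHs//]; exists i.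
Qed.

Lemma prime_idealr_exp J x n : x ^+ n \in J -> x \in J.
Proof.
elim: n => [|n IHn]; first by rewrite idealr1.
by rewrite exprS prime_idealrM => /orP[].
Qed.

Lemma is_ideal_sum I (T : finType) (D : pred T) (x : T -> R) : is_ideal I ->
  (forall i, D i -> I (x i)) -> I (\sum_(i | D i) x i).
Proof.
move=> [I0 Il] Ix; elim/big_ind: _ => // u v Iu Iv.
by rewrite -[u]mul1r; exact: Il.
Qed.

Lemma is_idealM I a x : is_ideal I -> I x -> I (a * x).
Proof. by move=> [I0 Il] Ix; rewrite -[_ * _]addr0; exact: Il. Qed.

Lemma is_idealD I x y : is_ideal I -> I x -> I y -> I (x + y).
Proof. by move=> [I0 Il] Ix Iy; rewrite -[x]mul1r; exact: Il. Qed.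

End IdealTheory.

(** * Types of prime ideals and the ideals cut out by marks *)

Section MarkIdeals.
Variables (p : nat) (S : finGroupType) (F : fusion_system S).
Hypothesis p_pr : prime p.
Implicit Types P Q : {group S}.
Local Open Scope classical_set_scope.
Local Notation A := (fburnside_loc p F).
Implicit Types J : prime_idealr A.

Lemma is_ideal_0 P : is_ideal (ideal_0 p F P).
Proof.
split; first exact: rmorph0.
by move=> a x y /= x0 y0; rewrite /ideal_0 /= rmorphD rmorphM /= x0 y0 mulr0 addr0.
Qed.

Lemma is_ideal_p : is_ideal (ideal_p p F).
Proof.
split; first by exists 0; rewrite rmorph0 mulr0.
move=> a x y [z xz] [t yt]; exists (lmark [set: S]%G a * z + t).
by rewrite rmorphD rmorphM /= xz yt mulrDr mulrCA.
Qed.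

Lemma lscal_notin J (a u : zlocal p) : u * a = 1 -> lscal F a \notin J.
Proof.
move=> ua; apply/negP => /(idealMr (lscal F u)).
by rewrite -rmorphM ua rmorph1 idealr1.
Qed.

Lemma natr_coprime_notin J n : coprime p n -> n%:R \notin J.
Proof.
move=> pn; have [u un] := zlocal_inv p_pr (pn : coprime p `|n%:Z|).
by rewrite -(rmorph_nat (@lscal p S F)); apply: lscal_notin un.
Qed.

(** Split off the power of p dividing [n]: the cofactor is a unit, hence outside [J], so the power
    of p, and then p itself, lies in [J]. *)
Lemma natr_in_p J n : (0 < n)%N -> n%:R \in J -> p%:R \in J.
Proof.
move=> n0; have [m pm ->] := pfactor_coprime p_pr n0.
rewrite natrM prime_idealrM (negbTE (natr_coprime_notin J pm)) natrX.
exact: prime_idealr_exp.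
Qed.

(** Integers coprime to p are units, so the type can only be p or 0, and membership of p decides
    which. *)
Lemma ideal_type_p J : ideal_type J p <-> p%:R \in J.
Proof.
split=> [/ideal_typeP/(_ p)|Jp]; first by rewrite dvdnn.
apply/ideal_typeP => n; apply/idP/idP => [|/dvdnP[k ->]]; last first.
  by rewrite natrM idealMr.
by apply: contraLR; rewrite -prime_coprime //; exact: natr_coprime_notin.
Qed.

Lemma ideal_type_0 J : ideal_type J 0 <-> p%:R \notin J.
Proof.
split=> [/ideal_typeP->|Jp]; first by rewrite dvd0n -lt0n prime_gt0.
apply/ideal_typeP => n; rewrite dvd0n; case: n => [|n]; first by rewrite idealr0.
by apply: contraNF Jp; exact: natr_in_p.
Qed.

Lemma ideal_0_exists P :
  exists2 J : prime_idealr A, [set` J] = ideal_0 p F P & ideal_type J 0.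
Proof.
have [|u v|J JE] := prime_ideal_exists (is_ideal_0 P).
- by rewrite /ideal_0 /= rmorph1; apply/eqP; rewrite oner_eq0.
- by rewrite /ideal_0 /= rmorphM; exact: zlocal_mulIf.
exists J => //; apply/ideal_type_0/negP => Jp.
have : [set` J] p%:R by [].
rewrite JE /ideal_0 /= rmorph_nat pmulrn => /eqP.
by rewrite zlocal_eq_int eqz_nat; case: p p_pr.
Qed.

Lemma ideal_0_type J : ideal_type J 0 -> exists P, [set` J] = ideal_0 p F P.
Proof.
move=> /ideal_type_0 Jp.
have [P sPJ] : exists P, forall x, lmark P x = 0 -> x \in J.
  apply: contrapT => nP.
  have /fin_all_exists2[x x0 xJ] P : exists2 x : A, lmark P x = 0 & x \notin J.
    apply: contrapT => nx; apply: nP; exists P => x x0; apply: contrapT => /negP xJ.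
    by apply: nx; exists x.
  have : \prod_P x P \in J by rewrite (prod_lmark_eq0 p_pr x0) idealr0.
  by case/prime_idealr_prod => P; apply/negP.
exists P; apply/seteqP; split=> x /=; last exact: sPJ.
(* As x - Phi_P(x) lies in J_{P,0}, hence in [J], so does the scalar Phi_P(x). Were it nonzero,
   clearing its denominator would put a nonzero integer, hence p, in [J]. *)
move=> Jx; apply/eqP; apply: contraNT Jp => x0.
have [n [m [u uK E]]] := zlocal_frac p_pr (lmark P x).
have Jmx : lscal F (lmark P x) \in J.
  have : x - lscal F (lmark P x) \in J.
    by apply: sPJ; rewrite rmorphB /= lmark_scal subrr.
  by move/(rpredB Jx); rewrite opprB addrC subrK.
have : `|m|%N%:R \in J.
  have : lscal F (n%:~R * lmark P x) \in J by rewrite rmorphM; exact: idealMr.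
  rewrite E mulrA [n%:~R * u]mulrC uK mul1r rmorph_int => Jm.
  have : m%:~R * (sgz m)%:~R \in J by rewrite mulrC idealMr.
  by rewrite -intrM mulrC -abszEsg -pmulrn.
apply: natr_in_p; rewrite absz_gt0; apply: contraNneq x0 => m0.
by rewrite E m0 mulr0.
Qed.

Lemma ideal_0_fclass P Q :
  ideal_0 p F P `<=` ideal_0 p F Q <-> fclass F P = fclass F Q.
Proof.
split=> [sPQ | eqPQ x]; first by apply: (@lmark_separate p) => x; exact: sPQ.
by rewrite /ideal_0 /= (lmark_fclass p_pr eqPQ).
Qed.

(** A smaller prime omits p as well, so it is some J_{Q,0}, and nested ideals of this form come from
    one class. *)
Lemma ideal_0_minimal P J : [set` J] = ideal_0 p F P -> ideal_type J 0 ->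
  minimal_prime J.
Proof.
move=> JE /ideal_type_0 Jp I sIJ.
have /ideal_0_type[Q IE] : ideal_type I 0.
  by apply/ideal_type_0; apply: contra Jp; exact: sIJ.
have QP : fclass F Q = fclass F P.
  by apply/ideal_0_fclass; rewrite -IE -JE => x; exact: sIJ.
move=> x; apply/idP/idP => [|Jx]; first exact: sIJ.
have : [set` J] x by [].
by rewrite JE => /((ideal_0_fclass P Q).2 (esym QP)); rewrite -IE.
Qed.

Hypothesis pS : (p.-group [set: S]%G)%g.

Lemma ideal_0_sub_p P : ideal_0 p F P `<=` ideal_p p F.
Proof.
move=> x; have [z] := lmark_mod p_pr P x pS; rewrite /ideal_0 /= => -> /eqP.
by rewrite addr_eq0 => /eqP E; exists (- z); rewrite E mulrN.
Qed.

(** Primality and maximality both come from Z_(p) being local: a mark at [S] outside p Z_(p) is a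
    unit. *)
Lemma ideal_p_exists : exists J : prime_idealr A,
  [/\ [set` J] = ideal_p p F, ideal_type J p & maximal_ideal J].
Proof.
have nu z : p%:R * z <> 1 :> zlocal p by apply/eqP; exact: zlocal_p_not_unit.
have [|u v|J JE] := prime_ideal_exists is_ideal_p.
- by case=> z; rewrite rmorph1 => /esym; exact: nu.
- case=> z; rewrite rmorphM /=.
  have [[w wu]|[t ut]] := zlocal_unit_or_dvd p_pr (lmark [set: S]%G u); last first.
    by left; exists t.
  by move=> E; right; exists (w * z); rewrite mulrCA -E mulrA wu mul1r.
have Jp : p%:R \in J.
  by have : [set` J] p%:R; [rewrite JE; exists 1; rewrite rmorph_nat mulr1 |].
exists J; split=> //; first exact/ideal_type_p.
move=> I sJI x; apply/idP/idP => [Ix|]; last exact: sJI.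
have [[w wx]|[t xt]] := zlocal_unit_or_dvd p_pr (lmark [set: S]%G x); last first.
  by have : [set` J] x; [rewrite JE; exists t |].
(* With [w] inverse to Phi_S(x), the element w x - 1 has mark 0 at [S]. Both w x and w x - 1 lie in
   [I], hence so does 1, although [I] is proper. *)
have /sJI : lscal F w * x - 1 \in J.
  have : [set` J] (lscal F w * x - 1); last by [].
  rewrite JE; exists 0.
  by rewrite rmorphB rmorphM /= lmark_scal wx rmorph1 subrr mulr0.
move/(rpredB (idealMr (lscal F w) Ix)).
by rewrite opprB addrC subrK idealr1.
Qed.

Lemma ideal_p_sub J : ideal_type J p -> ideal_p p F `<=` [set` J].
Proof.
move=> /ideal_type_p Jp x [z xz] /=.
have /fin_all_exists[t tE] P : exists t, lmark P x = p%:R * t.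
  by have [k ->] := lmark_mod p_pr P x pS; exists (z + k); rewrite xz mulrDr.
have : \prod_P (x - lscal F (lmark P x)) \in J.
  rewrite (prod_lmark_eq0 p_pr) ?idealr0 // => P.
  by rewrite rmorphB /= lmark_scal subrr.
case/prime_idealr_prod => P; rewrite tE => JP.
have JpP : lscal F (p%:R * t P) \in J by rewrite mulrC rmorphM rmorph_nat idealMr.
by have := rpredD JP JpP; rewrite subrK.
Qed.

End MarkIdeals.

(** * Generators *)

Section Basis.
Variables (S : finGroupType) (F : fusion_system S).
Implicit Types P Q : {group S}.
Local Notation top := (fclass F [set: S]%G).

Lemma fclass_in P : fclass F P \in fclasses F.
Proof. exact: imset_f. Qed.

Lemma fsub_card P Q : fsub F P Q -> (#|P| <= #|Q|)%N.
Proof.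
case/set0Pn=> f fPQ; rewrite -(card_in_imset (fhom_inj fPQ)).
by apply/subset_leq_card/subsetP => _ /imsetP[x Px ->]; exact: fhom_in fPQ Px.
Qed.

(** Passes from classes, which index the basis, to proper subgroups, which index the generators. *)
Lemma fclasses_proper C : C \in fclasses F -> C != top ->
  exists2 P : {group S}, P \proper [set: S] & C = fclass F P.
Proof.
case/imsetP=> P _ -> ntop; exists P => //; rewrite properT.
by apply: contra ntop => /eqP E; rewrite (_ : P = [set: S]%G) //; apply: val_inj.
Qed.

Lemma fully_normalized_rep C : C \in fclasses F ->
  exists2 P : {group S}, fully_normalized F P & C = fclass F P.
Proof.
case/imsetP=> P0 _ ->; have P0C : P0 \in fclass F P0 by rewrite inE fisog_refl.
have [P PC maxP] := arg_maxnP (fun Q => #|'N(Q)%g|) P0C.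
have eqC : fclass F P0 = fclass F P.
  by apply/fclass_eqP; move: (PC : P \in fclass F P0); rewrite inE.
exists P => //; apply/forall_inP => Q; rewrite -eqC; exact: maxP.
Qed.

Lemma fully_normalized_top : fully_normalized F [set: S]%G.
Proof.
apply/forall_inP => Q _; apply/subset_leq_card/(subset_trans (subsetT _)).
exact: normG.
Qed.

Lemma burnside_coef1 P :
  burnside_coef P (1 : burnside [set: S]%G) = (P == [set: S]%G)%:R.
Proof.
rewrite [LHS](groth_lift_in _ (1 : bsemi [set: S]%G)) /= [LHS]semi_coef_bclass.
have C1 (x : unit) : ('C_[set: S][x | triv_act [set: S]%G unit] = [set: S])%g.
  by apply/setP=> g; rewrite !inE sub1set inE.
rewrite /act_coef; case: eqP => [-> | nPT].
  rewrite (_ : [set x | _] = [set tt]) ?imset_set1 ?cards1 //.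
  by apply/setP=> -[]; rewrite in_set C1 in_set1 !eqxx.
rewrite (_ : [set x | _] = set0) ?imset0 ?cards0 //.
apply/setP=> x; rewrite in_set C1 in_set0; apply/eqP => E; apply: nPT; exact: val_inj.
Qed.

Lemma burnside_coef_sum P (T : finType) (D : pred T) (x : T -> fburnside F)
    (c : T -> int) :
  burnside_coef P (fbval (\sum_(i | D i) x i *~ c i)) =
  \sum_(i | D i) burnside_coef P (x i) *~ c i.
Proof.
rewrite -[LHS]/((burnside_coef P \o (val : fburnside F -> _)) _) raddf_sum.
by apply: eq_bigr => i _; rewrite raddfMz.
Qed.

Variable alpha : {set {group S}} -> fburnside F.
Hypothesis alphaB : reeh_basis alpha.

(** By order, [S] admits no injective map to [P]. *)
Lemma reeh_mark_proper P : P \proper [set: S] ->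
  fmark [set: S]%G (alpha (fclass F P)) = 0.
Proof.
move=> ltPS; apply/eqP; rewrite -[_ == 0]negbK (reeh_mark_supp alphaB).
by apply/negP => /fsub_card; rewrite leqNgt proper_card.
Qed.

(* Read off the coefficients of 1 on the basis at fully normalized
   representatives. *)
Lemma reeh_top : alpha top = 1.
Proof.
have [c cE] := reeh_gen alphaB 1.
(* At a fully normalized [P], only the basis element of its class has a nonzero coefficient, and
   that coefficient is 1. *)
have coefE P : fully_normalized F P -> c (fclass F P) = (P == [set: S]%G)%:R.
  move=> nP; rewrite -burnside_coef1 -[1]/(fbval (1 : fburnside F)) cE.
  rewrite burnside_coef_sum (bigD1 (fclass F P)) ?fclass_in //=.
  rewrite big1 ?addr0 => [|C /andP[FC nC]].
    by rewrite (reeh_coef_diag alphaB) // intz.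
  by rewrite (reeh_coef_off alphaB) // mul0rz.
rewrite cE (bigD1 top) ?fclass_in //= coefE ?fully_normalized_top // eqxx.
rewrite big1 ?addr0 // => C /andP[/fully_normalized_rep[P nP ->] nT].
rewrite coefE //; case: (P =P [set: S]%G) nT => [-> | _ _]; first by rewrite eqxx.
exact: mulr0z.
Qed.

Variable p : nat.
Hypothesis p_pr : prime p.
Local Notation A := (fburnside_loc p F).

Lemma reeh_loc_gen (x : A) : exists a : {set {group S}} -> zlocal p,
  x = \sum_(C in fclasses F) lscal F (a C) * floc p (alpha C).
Proof.
have [n [u [X [_ ->]]]] := floc_frac p_pr x.
have [c ->] := reeh_gen alphaB X; exists (fun C => u * (c C)%:~R).
rewrite raddf_sum mulr_sumr; apply: eq_bigr => C _ /=.
by rewrite -lscal_int rmorphM mulrA.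
Qed.

Local Open Scope classical_set_scope.

(** In the expansion of x on the basis, every term off the top class is a multiple of a generator
    and has mark 0 at [S]. The top coefficient is therefore Phi_S(x), a multiple of p. *)
Lemma ideal_p_gen : ideal_p p F = ideal_gen (gens_p p alpha).
Proof.
apply/seteqP; split=> [x xp I [Iid sGI]|]; last first.
  apply: smallest_sub; first exact: is_ideal_p.
  move=> _ [[P ltPS <-]|->].
    by exists 0; rewrite lmark_floc reeh_mark_proper // mulr0.
  by exists 1; rewrite reeh_top rmorph1 rmorph_nat mulr1.
have [a xE] := reeh_loc_gen x.
have alI C : C \in fclasses F -> C != top -> I (floc p (alpha C)).
  move=> FC /(fclasses_proper FC)[P ltPS ->].
  by apply: sGI; left; exists P.
move: xp; rewrite xE (bigD1 top) ?fclass_in //= reeh_top rmorph1 mulr1.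
set y := \sum_(C | _) _ => -[z].
have Iy : I y.
  by apply: is_ideal_sum => // C /andP[FC nT]; apply: is_idealM => //; exact: alI.
have y0 : lmark [set: S]%G y = 0.
  rewrite rmorph_sum big1 // => C /andP[FC /(fclasses_proper FC)[P ltPS ->]].
  by rewrite /= lmark_scal_floc reeh_mark_proper // mulr0.
rewrite rmorphD /= y0 addr0 lmark_scal => ->; apply: is_idealD => //.
rewrite mulrC rmorphM rmorph_nat; apply: is_idealM => //; apply: sGI; right.
by rewrite reeh_top rmorph1.
Qed.

(** Applying Phi_P to the expansion of x gives a vanishing combination of the Phi_P(alpha_C).
    Subtracting it replaces each alpha_C by alpha_C - Phi_P(alpha_C), and the top term drops out
    because [alpha top] is 1. *)
Lemma ideal_0_gen P : ideal_0 p F P = ideal_gen (gens_0 p alpha P).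
Proof.
apply/seteqP; split=> [x xP I [Iid sGI]|]; last first.
  apply: smallest_sub; first exact: is_ideal_0.
  move=> _ [Q ltQS <-]; rewrite /ideal_0 /= reeh_top rmorph1.
  by rewrite rmorphB rmorph_int /= lmark_floc subrr.
have [a xE] := reeh_loc_gen x.
pose g C := floc p (alpha C) - (fmark P (alpha C))%:~R.
have gI C : C \in fclasses F -> C != top -> I (g C).
  move=> FC /(fclasses_proper FC)[Q ltQS ->].
  by apply: sGI; exists Q => //; rewrite reeh_top rmorph1.
have -> : x = \sum_(C in fclasses F | C != top) lscal F (a C) * g C.
  suff E : x = \sum_(C in fclasses F) lscal F (a C) * g C.
    rewrite {1}E (bigD1 top) ?fclass_in //= /g reeh_top !rmorph1 subrr.
    by rewrite mulr0 add0r.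
  have lE : \sum_(C in fclasses F) a C * (fmark P (alpha C))%:~R = 0.
    rewrite -[RHS]xP xE rmorph_sum; apply: eq_bigr => C _.
    by rewrite /= lmark_scal_floc.
  rewrite -[LHS]subr0 -[X in _ - X](rmorph0 (@lscal p S F)) -lE rmorph_sum {1}xE.
  rewrite -sumrB; apply: eq_bigr => C _.
  by rewrite /= rmorphM rmorph_int mulrBr.
by apply: is_ideal_sum => // C /andP[FC nT]; apply: is_idealM => //; exact: gI.
Qed.

End Basis.

Theorem theorem4p2 (p : nat) (S : finGroupType) (F : fusion_system S) :
  prime p -> (p.-group [set: S])%g -> saturated F p ->
  [/\ (forall J : prime_idealr (fburnside_loc p F),
         ideal_type J p \/ ideal_type J 0),
      (exists J : prime_idealr (fburnside_loc p F),
         [/\ [set` J]%classic = ideal_p p F,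
             ideal_type J p,
             maximal_ideal J
           & forall J' : prime_idealr (fburnside_loc p F),
               ideal_type J' p -> J' =i J]),
      [/\ (forall P : {group S}, exists J : prime_idealr (fburnside_loc p F),
             [/\ [set` J]%classic = ideal_0 p F P,
                 ideal_type J 0,
                 minimal_prime J
               & ([set` J] `<=` ideal_p p F)%classic]),
          (forall J : prime_idealr (fburnside_loc p F), ideal_type J 0 ->
             exists P : {group S}, [set` J]%classic = ideal_0 p F P),
          (forall P Q : {group S},
             ideal_0 p F P = ideal_0 p F Q <-> fclass F P = fclass F Q)
        & exists E : 'I_#|fclasses F| -> prime_idealr (fburnside_loc p F),
             (forall i, ideal_type (E i) 0) /\
             (forall J : prime_idealr (fburnside_loc p F), ideal_type J 0 ->
                exists! i, J =i E i)]
    & forall alpha : {set {group S}} -> fburnside F, reeh_basis alpha ->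
        ideal_p p F = ideal_gen (gens_p p alpha) /\
        (forall P : {group S}, ideal_0 p F P = ideal_gen (gens_0 p alpha P))].
Proof.
move=> p_pr pS _.
have eq0 P Q : ideal_0 p F P = ideal_0 p F Q <-> fclass F P = fclass F Q.
  split=> [E | PQ]; first by apply/(ideal_0_fclass _ p_pr); rewrite E.
  by apply/seteqP; split; apply/(ideal_0_fclass _ p_pr).
split.
- move=> J; case: (boolP (p%:R \in J)) => Jp.
    by left; apply/(ideal_type_p p_pr).
  by right; apply/(ideal_type_0 p_pr).
- have [J [JE Jp Jmax]] := ideal_p_exists F p_pr; exists J; split=> // J' J'p.
  by apply: Jmax => x Jx; apply: (ideal_p_sub p_pr pS J'p); rewrite -JE.
- split=> //; last 1 first.
  (* [E] chooses, for the i-th class, the ideal J_{P,0} of a representative [P], and [EE] remembers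
     that representative. *)
  + have /fin_all_exists2[E EE E0] (i : 'I_#|fclasses F|) :
        exists2 J : prime_idealr (fburnside_loc p F),
          (exists2 P : {group S}, enum_val i = fclass F P
             & [set` J]%classic = ideal_0 p F P)
        & ideal_type J 0.
      have /imsetP[P _ iP] := enum_valP i; have [J JE J0] := ideal_0_exists F p_pr P.
      by exists J => //; exists P.
    exists E; split=> // J /(ideal_0_type p_pr)[P JE].
    have FP := fclass_in F P.
    exists (enum_rank_in FP (fclass F P)); split=> [|j JEj].
      have [Q] := EE (enum_rank_in FP (fclass F P)).
      rewrite enum_rankK_in // => /eq0; rewrite -JE => <- EQ.
      exact/eq_idealr/esym.
    (* Uniqueness: if [J] is also the j-th ideal, then J_{P,0} = J_{Q,0} with [Q] in the j-th class,
       so the two classes agree. *)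
    have [Q jQ EQ] := EE j; apply: enum_val_inj; rewrite enum_rankK_in // jQ.
    apply/eq0; rewrite -JE -EQ; apply/seteqP.
    by split=> x /=; rewrite JEj.
  + move=> P; have [J JE J0] := ideal_0_exists F p_pr P; exists J; split=> //.
      exact: ideal_0_minimal JE J0.
    by rewrite JE; exact: ideal_0_sub_p.
  + exact: ideal_0_type.
- move=> alpha alphaB; split; first exact: ideal_p_gen.
  exact: ideal_0_gen.
Qed.
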